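(* Let $A\subset\mathbb{R}^n$ be a locally closed definable set and let $\mathcal{S}$ be a $\mathscr{C}^2$ stratification of $A$. Let $\mu>0$ and, for each $S\in\mathcal{S}$, let $U_S$ be a definable neighborhood of $S$ in $\mathbb{R}^n$. Then there exist definable $\mathscr{C}^1$ functions $\varphi_S:A\to[0,1]$, $S\in\mathcal{S}$, forming a partition of unity on $A$ subordinate to the covering $(U_S)_{S\in\mathcal{S}}$ (that is, $\sum_{S\in\mathcal{S}}\varphi_S=1$ on $A$ and $\operatorname{supp}\varphi_S\subset U_S$ for every $S\in\mathcal{S}$), such that for every $S\in\mathcal{S}$ and all $x\in (U_S\cap A)\setminus S$ $$|\nabla\varphi_S(x)|\le\frac{\mu}{d(x,S)}.$$
   Context: An o-minimal structure expanding $(\mathbb{R},+,\cdot)$ is a family $\mathcal{D}=(\mathcal{D}_n)_{n\in\mathbb{N}}$, $\mathcal{D}_n$ a Boolean algebra of subsets of $\mathbb{R}^n$, stable under Cartesian products and under projections $\mathbb{R}^n\to\mathbb{R}^{n-1}$ onto the first $n-1$ coordinates, containing all real algebraic sets, and such that every element of $\mathcal{D}_1$ is a finite union of intervals and points. It is polynomially bounded if for every function $f:\mathbb{R}\to\mathbb{R}$ with graph in $\mathcal{D}$ there are $a>0$, $p\in\mathbb{N}$ with $|f(x)|<x^p$ for all $x>a$. Throughout, $\mathcal{D}$ is a fixed polynomially bounded o-minimal structure expanding $(\mathbb{R},+,\cdot)$; ''definable'' means belonging to $\mathcal{D}$ (for sets) or having graph in $\mathcal{D}$ (for maps). $|\cdot|$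 is the euclidean norm and $d(x,S)$ the euclidean distance from $x$ to $S$. A $\mathscr{C}^k$ stratification of a definable set $A\subset\mathbb{R}^n$ is a finite partition of $A$ into definable $\mathscr{C}^k$ submanifolds of $\mathbb{R}^n$ (called strata). A function is said to be $\mathscr{C}^m$ on $A$ if it extends to a $\mathscr{C}^m$ function on an open neighborhood of $A$ in $\mathbb{R}^n$; each $\mathscr{C}^1$ function $\varphi_S$ on $A$ comes with such an extension, and $\nabla\varphi_S(x)$, $x\in A$, denotes the gradient of this extension at $x$. The right-hand side $\mu/d(x,S)$ is read as $+\infty$ when $d(x,S)=0$. *)

(* Defs.v *)
From HB Require Import structures.
From mathcomp Require Import all_boot all_order all_algebra.
From mathcomp Require mpoly.
From mathcomp Require Import all_classical all_reals all_analysis.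
Set Implicit Arguments.
Unset Strict Implicit.
Unset Printing Implicit Defensive.
Import Order.TTheory GRing.Theory Num.Theory.
Import numFieldNormedType.Exports.
Local Open Scope classical_set_scope.
Local Open Scope ring_scope.

(* The space R^n is 'rV[R]_n.  Its library norm `|x| is the sup norm, which
   gives the right topology, but all metric notions below are euclidean. *)

Definition euclidean_norm (R : realType) (n : nat) (x : 'rV[R]_n) : R :=
  Num.sqrt (\sum_(i < n) x 0 i ^+ 2).

(* Meaningful only for S nonempty: the library sets inf set0 = 0. *)
Definition euclidean_dist (R : realType) (n : nat) (x : 'rV[R]_n)
    (S : set 'rV[R]_n) : R :=
  inf [set euclidean_norm (x - y) | y in S].

Definition real_algebraic (R : realType) (n : nat) (A : set 'rV[R]_n) : Prop :=
  exists k : nat, exists p : 'I_k -> mpoly.mpoly n R,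
    A = [set x | forall j : 'I_k, mpoly.meval (fun i => x 0 i) (p j) = 0].

(* Points are the degenerate intervals `[a, a]; rays are allowed. *)
Definition finite_union_itv (R : realType) (A : set 'rV[R]_1) : Prop :=
  exists s : seq (interval R),
    A = [set x | exists2 J, J \in s & x 0 0 \in J].

Record ominimal_structure (R : realType)
    (D : forall n : nat, set (set 'rV[R]_n)) : Prop := OminimalStructure {
  omin_set0 : forall n, D n set0;
  omin_setC : forall n (A : set 'rV[R]_n), D n A -> D n (~` A);
  omin_setU : forall n (A B : set 'rV[R]_n), D n A -> D n B -> D n (A `|` B);
  omin_prod : forall m n (A : set 'rV[R]_m) (B : set 'rV[R]_n),
    D m A -> D n B ->
    D (m + n)%N [set z : 'rV[R]_(m + n) | A (lsubmx z) /\ B (rsubmx z)];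
  omin_proj : forall n (A : set 'rV[R]_(n + 1)),
    D (n + 1)%N A -> D n [set lsubmx z | z in A];
  omin_algebraic : forall n (A : set 'rV[R]_n), real_algebraic A -> D n A;
  omin_line : forall A : set 'rV[R]_1, D 1%N A -> finite_union_itv A
}.

Definition graph_on (R : realType) (n : nat) (A : set 'rV[R]_n)
    (f : 'rV[R]_n -> R) : set 'rV[R]_(n + 1) :=
  [set z | A (lsubmx z) /\ rsubmx z 0 0 = f (lsubmx z)].

Definition definable_fun_on (R : realType)
    (D : forall n : nat, set (set 'rV[R]_n)) (n : nat) (A : set 'rV[R]_n)
    (f : 'rV[R]_n -> R) : Prop :=
  D (n + 1)%N (graph_on A f).

Definition polynomially_bounded (R : realType)
    (D : forall n : nat, set (set 'rV[R]_n)) : Prop :=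
  forall f : R -> R,
    definable_fun_on D [set: 'rV[R]_1] (fun x => f (x 0 0)) ->
    exists a : R, exists p : nat,
      0 < a /\ forall x : R, a < x -> `|f x| < x ^+ p.

Definition locally_closed (T : topologicalType) (A : set T) : Prop :=
  exists V F : set T, [/\ open V, closed F & A = V `&` F].

(* Iterated partial derivatives up to order k exist and are continuous at every
   point of V; only meant for V open. *)
Fixpoint Ck_on (R : realType) (n : nat) (W : normedModType R) (k : nat)
    (V : set 'rV[R]_n) (f : 'rV[R]_n -> W) : Prop :=
  (forall x, V x -> {for x, continuous f}) /\
  (if k is k'.+1 then
     forall i : 'I_n,
       (forall x, V x -> derivable f x (delta_mx 0 i)) /\
       Ck_on k' V (fun x => 'D_(delta_mx 0 i) f x)
   else True).

Definition gradient (R : realType) (n : nat) (f : 'rV[R]_n -> R)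
    (x : 'rV[R]_n) : 'rV[R]_n :=
  \row_(i < n) 'D_(delta_mx 0 i) f x.

(* g is a C^k extension of f|_A to an open neighborhood of A; the values of g
   outside that neighborhood and of f outside A are irrelevant. *)
Definition Ck_extension (R : realType) (n k : nat) (A : set 'rV[R]_n)
    (f g : 'rV[R]_n -> R) : Prop :=
  exists V : set 'rV[R]_n,
    [/\ open V, A `<=` V, Ck_on k V g & forall x, A x -> g x = f x].

Definition Ck_diffeo (R : realType) (n k : nat) (V W : set 'rV[R]_n)
    (h : 'rV[R]_n -> 'rV[R]_n) : Prop :=
  exists g : 'rV[R]_n -> 'rV[R]_n,
    [/\ Ck_on k V h, Ck_on k W g,
        (forall x, V x -> W (h x) /\ g (h x) = x) &
        (forall y, W y -> V (g y) /\ h (g y) = y)].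

(* Around each of its points, S is straightened by a C^k diffeomorphism of R^n
   to R^d x {0}.  The dimension d may depend on the connected component. *)
Definition Ck_submanifold (R : realType) (n k : nat)
    (S : set 'rV[R]_n) : Prop :=
  forall x, S x ->
  exists d : nat, exists V W : set 'rV[R]_n, exists h : 'rV[R]_n -> 'rV[R]_n,
    [/\ (d <= n)%N, open V /\ V x, open W, Ck_diffeo k V W h &
        forall y, V y -> (S y <-> forall i : 'I_n, (d <= i)%N -> h y 0 i = 0)].

(* The library's partition includes nonemptiness of the blocks, so that s |-> S s
   is injective and I indexes the set of strata faithfully. *)
Definition Ck_stratification (R : realType)
    (D : forall n : nat, set (set 'rV[R]_n)) (n k : nat) (I : finType)
    (A : set 'rV[R]_n) (S : I -> set 'rV[R]_n) : Prop :=
  classical_sets.partition [set: I] S A /\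
  forall s : I, D n (S s) /\ Ck_submanifold k (S s).

(* Support of a function on the space A, i.e. the closure is taken in A. *)
Definition support_in (R : realType) (n : nat) (A : set 'rV[R]_n)
    (f : 'rV[R]_n -> R) : set 'rV[R]_n :=
  A `&` closure (A `&` [set x | f x != 0]).

(* Main.v *)
(* Squared distances can be smoothed inside D: for F nonempty and g = d(., F)^2,
   the Lasry-Lions regularization h(x) = sup_z (g(z) - 2 |x - z|^2) is first-order
   definable from F, satisfies g <= h <= 2 g and |grad h|^2 <= 64 h, and is C^1
   with Lipschitz gradient because z |-> g(z) - |z|^2 is concave.  This replaces
   tubular neighbourhoods and the Lojasiewicz inequality.

   If theta is a cutoff with |t theta'(t)| small (a step function of an iterated
   square root of t), then chi = theta (h_P / (h_P + h_F)) is 1 near P \ F, 0 near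
   F \ P, and |grad chi|^2 <= kappa / h_P.  Refine the strata to pieces P_0, P_1,
   ... of A whose initial unions Z_k = P_0 u ... u P_{k-1} are relatively closed,
   take chi_k for P = P_k and F = Z_k u ~U_k, and put
   phi_k = chi_k * prod_{i<k} (1 - chi_i).  Wherever chi_k is not flat, x is closer
   to P_k than to the earlier pieces (up to a constant), so the gradients of the
   chi_i, i < k, are controlled by 1 / d(x, P_k) as well. *)
Require Import Defs.
From HB Require Import structures.
From mathcomp Require Import all_boot all_order all_algebra.
From mathcomp Require Import (canonicals) mpoly.
From mathcomp Require Import all_classical all_reals all_analysis.
From mathcomp Require Import ring lra.
Set Implicit Arguments.
Unset Strict Implicit.
Unset Printing Implicit Defensive.
Import Order.TTheory GRing.Theory Num.Theory.
Import numFieldNormedType.Exports.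
Local Open Scope classical_set_scope.
Local Open Scope ring_scope.

(** Two obstacles shape the argument. First, [mu] is arbitrary, while an ordinary cutoff in the
    ratio of the distances has gradient at most some fixed constant over the distance. Since the
    gradient of log d^2 is already of order 1/d, the smallness must come from t theta'(t), so theta
    has to descend over a long interval of log t. A logarithm is not definable in a polynomially
    bounded structure, but t^(1/2^m) is, and its logarithmic derivative is 2^-m. Second, h_P / (h_P
    + h_F) is singular where the closures of P and F meet, and A may contain such points, for
    instance on frontiers of strata. The order of the pieces hides them: a point of P_j avoids the
    singular set of chi_k for every k <= j, because Z_k and Z_{k+1} are relatively closed, and for k
    > j the factor 1 - chi_j of phi_k vanishes identically near it. All estimates are kept in
    squared form, so kappa plays the part of mu^2, up to factors depending only on the number of
    pieces. *)

Section Coordinates.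
Variable R : realType.

(* Types identified with some R^k, so that definability can be stated for sets and
   functions over products without index bookkeeping. *)
Class coordinates (X : Type) := Coordinates {
  cdim : nat;
  enc : X -> 'rV[R]_cdim;
  dec : 'rV[R]_cdim -> X;
  encK : cancel enc dec;
  decK : cancel dec enc
}.
Arguments cdim X {_}.

#[export] Instance coordinates_rV n : coordinates 'rV[R]_n :=
  @Coordinates 'rV[R]_n n id id (fun=> erefl) (fun=> erefl).

#[export] Program Instance coordinates_R : coordinates R :=
  @Coordinates R 1 (fun a => \row_(i < 1) a) (fun v => v 0 0) _ _.
Next Obligation. by move=> a; rewrite mxE. Qed.
Next Obligation. by move=> v; apply/rowP => i; rewrite mxE ord1. Qed.

#[export] Program Instance coordinates_prod X Y (cX : coordinates X)
    (cY : coordinates Y) : coordinates (X * Y) :=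
  @Coordinates (X * Y) (cdim X + cdim Y) (fun p => row_mx (enc p.1) (enc p.2))
    (fun v => (dec (lsubmx v), dec (rsubmx v))) _ _.
Next Obligation. by move=> X Y cX cY [x y]; rewrite row_mxKl row_mxKr !encK. Qed.
Next Obligation. by move=> X Y cX cY v; rewrite !decK hsubmxK. Qed.

(* Maps that only project, permute and duplicate coordinates. *)
Definition coordinate_map X Y {cX : coordinates X} {cY : coordinates Y}
    (u : X -> Y) : Prop :=
  exists s : 'I_(cdim Y) -> 'I_(cdim X), forall x j, enc (u x) 0 j = enc x 0 (s j).

Lemma coordinate_id X {cX : coordinates X} : coordinate_map (fun x : X => x).
Proof. by exists id. Qed.

Lemma coordinate_fst X Y Z {cX : coordinates X} {cY : coordinates Y}
    {cZ : coordinates Z} (u : X -> Y * Z) :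
  coordinate_map u -> coordinate_map (fun x => (u x).1).
Proof.
by move=> [s us]; exists (fun j => s (lshift _ j)) => x j; rewrite -us /= row_mxEl.
Qed.

Lemma coordinate_snd X Y Z {cX : coordinates X} {cY : coordinates Y}
    {cZ : coordinates Z} (u : X -> Y * Z) :
  coordinate_map u -> coordinate_map (fun x => (u x).2).
Proof.
by move=> [s us]; exists (fun j => s (rshift _ j)) => x j; rewrite -us /= row_mxEr.
Qed.

Lemma coordinate_pair X Y Z {cX : coordinates X} {cY : coordinates Y}
    {cZ : coordinates Z} (u : X -> Y) (v : X -> Z) :
  coordinate_map u -> coordinate_map v -> coordinate_map (fun x => (u x, v x)).
Proof.
move=> [s us] [t vt].
exists (fun j : 'I_(cdim Y + cdim Z) =>
  match fintype.split j with inl a => s a | inr b => t b end) => x j /=.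
by rewrite mxE; case: (fintype.split j) => a; rewrite ?us ?vt.
Qed.

Lemma coordinate_entry X {cX : coordinates X} n (u : X -> 'rV[R]_n) i :
  coordinate_map u -> coordinate_map (fun x => u x 0 i).
Proof. by move=> [s us]; exists (fun=> s i) => x j; rewrite -us /= mxE. Qed.

End Coordinates.

Arguments cdim {R} X {_}.

Ltac coordinates_tac :=
  repeat first [exact: coordinate_id | apply: coordinate_fst
    | apply: coordinate_snd | apply: coordinate_pair | apply: coordinate_entry].

(** * First-order definability in D *)

Section Definability.
Variables (R : realType) (D : forall n : nat, set (set 'rV[R]_n)).
Hypothesis D_omin : ominimal_structure D.

Definition definable_set X {cX : coordinates R X} (A : X -> Prop) : Prop :=
  D [set v | A (dec v)].

Definition definable_fun X {cX : coordinates R X} (f : X -> R) : Prop :=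
  definable_set (fun p : X * R => p.2 = f p.1).

Definition polynomial_fun X {cX : coordinates R X} (f : X -> R) : Prop :=
  exists p : mpoly.mpoly (cdim X) R, forall x, f x = mpoly.meval (fun i => enc x 0 i) p.

Lemma definable_setE X {cX : coordinates R X} (A B : X -> Prop) :
  (forall x, A x <-> B x) -> definable_set B -> definable_set A.
Proof. by move=> AB; have -> : A = B by apply/funext => x; apply/propext. Qed.

Lemma definable_funE X {cX : coordinates R X} (f g : X -> R) :
  f =1 g -> definable_fun g -> definable_fun f.
Proof. by move/funext => ->. Qed.

Lemma definable_not X {cX : coordinates R X} (A : X -> Prop) :
  definable_set A -> definable_set (fun x => ~ A x).
Proof. exact: omin_setC. Qed.

Lemma definable_or X {cX : coordinates R X} (A B : X -> Prop) :
  definable_set A -> definable_set B -> definable_set (fun x => A x \/ B x).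
Proof. exact: omin_setU. Qed.

Lemma definable_and X {cX : coordinates R X} (A B : X -> Prop) :
  definable_set A -> definable_set B -> definable_set (fun x => A x /\ B x).
Proof.
move=> dA dB; apply: (@definable_setE _ _ _ (fun x => ~ (~ A x \/ ~ B x))).
  by move=> x; rewrite not_orE !notK; split.
by apply/definable_not/definable_or; apply: definable_not.
Qed.

Lemma definable_imp X {cX : coordinates R X} (A B : X -> Prop) :
  definable_set A -> definable_set B -> definable_set (fun x => A x -> B x).
Proof.
move=> dA dB; apply: (@definable_setE _ _ _ (fun x => ~ A x \/ B x)).
  by move=> x; rewrite implyE; split.
by apply: definable_or => //; apply: definable_not.
Qed.

Lemma definable_False X {cX : coordinates R X} : definable_set (fun _ : X => False).
Proof. exact: omin_set0. Qed.

Lemma definable_True X {cX : coordinates R X} : definable_set (fun _ : X => True).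
Proof.
apply: (@definable_setE _ _ _ (fun _ => ~ False)); first by move=> _; tauto.
exact/definable_not/definable_False.
Qed.

Lemma definable_const X {cX : coordinates R X} (P : Prop) :
  definable_set (fun _ : X => P).
Proof.
have [p|np] := pselect P.
  by apply: definable_setE definable_True => x; split.
by apply: definable_setE definable_False => x; split.
Qed.

Lemma definable_castmx m m' (e : m = m') (A : set 'rV[R]_m) :
  D A -> D [set x : 'rV[R]_m' | A (castmx (erefl, esym e) x)].
Proof. by case: m' / e => dA; rewrite (_ : [set _ | _] = A). Qed.

(** The axiom [omin_proj] drops a single coordinate; induction on [k] iterates it, the casts
    reconciling [n + k.+1] with [(n + k) + 1]. *)
Lemma definable_lsubmx n k (A : set 'rV[R]_(n + k)) :
  D A -> D [set lsubmx z | z in A].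
Proof.
elim: k A => [|k IH] A dA.
  have := definable_castmx (addn0 n) dA; congr (D _).
  rewrite eqEsubset; split => [x /= Ax|x [z Az <-]] /=.
    exists (castmx (erefl, esym (addn0 n)) x) => //.
    by apply/rowP => i; rewrite mxE castmxE /=; congr (x _ _); apply/val_inj.
  rewrite (_ : castmx _ _ = z) //.
  apply/rowP => i; rewrite castmxE mxE /=; congr (z _ _).
    by apply/val_inj.
  by apply/val_inj.
have e : (n + k.+1 = (n + k) + 1)%N by rewrite addn1 addnS.
have := IH _ (omin_proj D_omin (definable_castmx e dA)); congr (D _).
rewrite eqEsubset; split => [x [_ [z Az <-] <-]|x [z Az <-]] /=.
  exists (castmx (erefl, esym e) z) => //.
  by apply/rowP => i; rewrite !mxE castmxE /=; congr (z _ _); apply/val_inj.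
exists (lsubmx (castmx (erefl, e) z)).
  exists (castmx (erefl, e) z) => //=.
  rewrite (_ : castmx _ _ = z) //.
  by apply/rowP => i; rewrite !castmxE /=; congr (z _ _); apply/val_inj.
by apply/rowP => i; rewrite !mxE castmxE /=; congr (z _ _); apply/val_inj.
Qed.

Lemma definable_ex X Y {cX : coordinates R X} {cY : coordinates R Y}
    (B : X -> Y -> Prop) :
  definable_set (fun p : X * Y => B p.1 p.2) ->
  definable_set (fun x => exists y, B x y).
Proof.
move=> /(@definable_lsubmx _ _ _); congr (D _).
rewrite eqEsubset; split => [_ [z /= Bz <-]|x [y Bxy]] /=.
  by exists (dec (rsubmx z)).
by exists (row_mx x (enc y)); rewrite /= ?row_mxKl ?row_mxKr ?encK.
Qed.

Lemma definable_all X Y {cX : coordinates R X} {cY : coordinates R Y}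
    (B : X -> Y -> Prop) :
  definable_set (fun p : X * Y => B p.1 p.2) ->
  definable_set (fun x => forall y, B x y).
Proof.
move=> dB; apply: (@definable_setE _ _ _ (fun x => ~ exists y, ~ B x y)).
  by move=> x; rewrite -forallNE; split => H y; have := H y; rewrite notK.
by apply/definable_not/definable_ex/definable_not.
Qed.

Lemma definable_forall_fin X {cX : coordinates R X} (T : finType)
    (B : T -> X -> Prop) :
  (forall t, definable_set (B t)) -> definable_set (fun x => forall t, B t x).
Proof.
move=> dB.
have dl (s : seq T) : definable_set (fun x => forall t, t \in s -> B t x).
  elim: s => [|t s IH].
    by apply: definable_setE definable_True => x; split.
  apply: definable_setE (definable_and (dB t) IH) => x; split.
    by move=> H; split => [|u us]; apply: H; rewrite in_cons ?eqxx ?us ?orbT.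
  by move=> [Bt H] u; rewrite in_cons => /orP[/eqP->|/H].
apply: definable_setE (dl (enum T)) => x; split => H t; first by [].
by apply: H; rewrite mem_enum.
Qed.

Lemma definable_exists_fin X {cX : coordinates R X} (T : finType)
    (B : T -> X -> Prop) :
  (forall t, definable_set (B t)) -> definable_set (fun x => exists t, B t x).
Proof.
move=> dB; apply: (@definable_setE _ _ _ (fun x => ~ forall t, ~ B t x)).
  by move=> x; rewrite -existsNE; split => -[t Bt]; exists t; rewrite ?notK // -[B t x]notK.
by apply/definable_not/definable_forall_fin => t; apply: definable_not.
Qed.

Lemma polynomial_coordinate X {cX : coordinates R X} (u : X -> R) :
  coordinate_map u -> polynomial_fun u.
Proof.
move=> [s us]; exists (mpoly.mpolyX R (mpoly.mnm1 (s ord0))) => x.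
by rewrite mpoly.mevalXU -us /= mxE.
Qed.

Lemma polynomial_cst X {cX : coordinates R X} (c : R) :
  polynomial_fun (fun _ : X => c).
Proof. by exists (mpoly.mpolyC _ c) => x; rewrite mpoly.mevalC. Qed.

Lemma polynomial_add X {cX : coordinates R X} (f g : X -> R) :
  polynomial_fun f -> polynomial_fun g -> polynomial_fun (fun x => f x + g x).
Proof.
by move=> [p fp] [q gq]; exists (p + q) => x; rewrite mpoly.mevalD fp gq.
Qed.

Lemma polynomial_mul X {cX : coordinates R X} (f g : X -> R) :
  polynomial_fun f -> polynomial_fun g -> polynomial_fun (fun x => f x * g x).
Proof.
by move=> [p fp] [q gq]; exists (p * q) => x; rewrite mpoly.mevalM fp gq.
Qed.

Lemma definable_polynomial_eq X {cX : coordinates R X} (f g : X -> R) :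
  polynomial_fun f -> polynomial_fun g -> definable_set (fun x => f x = g x).
Proof.
move=> [p fp] [q gq]; apply: (omin_algebraic D_omin).
exists 1%N, (fun=> p - q); rewrite eqEsubset; split => x /=.
  by rewrite fp gq decK => e _; rewrite mpoly.mevalB e subrr.
by move=> /(_ ord0) /eqP; rewrite mpoly.mevalB subr_eq0 fp gq decK => /eqP.
Qed.

(** The preimage is the projection of the product of the whole space with [B], intersected with the
    graph of [u]; that graph is algebraic, being cut out by equalities between coordinates. *)
Lemma definable_comp_coordinate X Y {cX : coordinates R X} {cY : coordinates R Y}
    (u : X -> Y) (B : Y -> Prop) :
  coordinate_map u -> definable_set B -> definable_set (fun x => B (u x)).
Proof.
move=> [s us] dB.
have dT : D [set: 'rV[R]_(cdim X)] := @definable_True X cX.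
have /(omin_prod D_omin dT) := dB.
set P := [set _ | _] => dP.
set E := [set z : 'rV[R]_(cdim X + cdim Y) | forall j, rsubmx z 0 j = lsubmx z 0 (s j)].
have dE : D E.
  apply: (omin_algebraic D_omin).
  exists (cdim Y), (fun j => mpoly.mpolyX R (mpoly.mnm1 (rshift _ j)) -
                   mpoly.mpolyX R (mpoly.mnm1 (lshift _ (s j)))).
  apply/funext => z; apply/propext; split => /= H j.
    by rewrite mpoly.mevalB !mpoly.mevalXU; have := H j; rewrite !mxE => ->; rewrite subrr.
  have := H j; rewrite mpoly.mevalB !mpoly.mevalXU !mxE => /eqP.
  by rewrite subr_eq0 => /eqP.
have := definable_lsubmx (@definable_and _ (coordinates_rV R _) P E dP dE).
congr (D _); rewrite eqEsubset; split => [_ [z [[_ Bz] Ez] <-]|x Bx] /=.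
  rewrite (_ : u _ = dec (rsubmx z)) //; apply: (can_inj (@encK R _ _)); rewrite decK.
  by apply/rowP => j; rewrite us decK Ez.
exists (row_mx x (enc (u (dec x)))); last by rewrite row_mxKl.
split; first by split => //=; rewrite row_mxKr encK.
by move=> j; rewrite row_mxKr row_mxKl us decK.
Qed.

Lemma definable_fun_comp X Y {cX : coordinates R X} {cY : coordinates R Y}
    (u : X -> Y) (f : Y -> R) :
  coordinate_map u -> definable_fun f -> definable_fun (fun x => f (u x)).
Proof.
move=> cu df.
apply: (@definable_comp_coordinate (X * R) (Y * R) _ _ (fun p => (u p.1, p.2))
          (fun q : Y * R => q.2 = f q.1)) => //.
case: cu => s us; apply: coordinate_pair; last by coordinates_tac.
exists (fun j => lshift _ (s j)) => -[x t] j.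
by rewrite us /= row_mxEl.
Qed.

(** The value of a function is eliminated by quantifying over its graph. *)
Lemma definable_app X {cX : coordinates R X} (B : X -> R -> Prop) (f : X -> R) :
  definable_set (fun p : X * R => B p.1 p.2) -> definable_fun f ->
  definable_set (fun x => B x (f x)).
Proof.
move=> dB df.
apply: (@definable_setE _ _ _ (fun x => exists t, B x t /\ t = f x)).
  by move=> x; split => [Bf|[t [Bt <-]]] //; exists (f x).
exact/definable_ex/definable_and.
Qed.

Lemma definable_app2 X {cX : coordinates R X} (B : R -> R -> Prop) (f g : X -> R) :
  definable_set (fun p : R * R => B p.1 p.2) ->
  definable_fun f -> definable_fun g -> definable_set (fun x => B (f x) (g x)).
Proof.
move=> dB df dg; apply: (@definable_app _ _ (fun x t => B (f x) t)) => //.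
apply: (@definable_app _ _ (fun (p : X * R) t => B t p.2) (fun p => f p.1)).
  apply: (@definable_comp_coordinate (X * R * R) (R * R) _ _
            (fun p => (p.2, p.1.2)) (fun p => B p.1 p.2)) => //.
  by coordinates_tac.
by apply: definable_fun_comp => //; coordinates_tac.
Qed.

Lemma definable_fun_coordinate X {cX : coordinates R X} (u : X -> R) :
  coordinate_map u -> definable_fun u.
Proof.
move=> cu; apply: (definable_fun_comp cu (f := id)).
by apply: definable_polynomial_eq; apply: polynomial_coordinate; coordinates_tac.
Qed.

Lemma definable_eq X {cX : coordinates R X} (f g : X -> R) :
  definable_fun f -> definable_fun g -> definable_set (fun x => f x = g x).
Proof.
apply: (definable_app2 (B := eq)).
by apply: definable_polynomial_eq; apply: polynomial_coordinate; coordinates_tac.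
Qed.

Lemma definable_fun_graph X {cX : coordinates R X} (B : X -> R -> Prop)
    (f : X -> R) :
  (forall x t, B x t <-> t = f x) ->
  definable_set (fun p : X * R => B p.1 p.2) -> definable_fun f.
Proof. by move=> Bf; apply: definable_setE => -[x t]; rewrite Bf. Qed.

Lemma definable_fun_cst X {cX : coordinates R X} (c : R) :
  definable_fun (fun _ : X => c).
Proof.
apply: definable_polynomial_eq; last exact: polynomial_cst.
by apply: polynomial_coordinate; coordinates_tac.
Qed.

Lemma definable_fun_app2 X {cX : coordinates R X} (G : R -> R -> R) (f g : X -> R) :
  definable_fun (fun p : R * R => G p.1 p.2) ->
  definable_fun f -> definable_fun g -> definable_fun (fun x => G (f x) (g x)).
Proof.
move=> dG df dg.
apply: (@definable_app (X * R) _ (fun p t => p.2 = G (f p.1) t) (fun p => g p.1)).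
  apply: (@definable_app (X * R * R) _ (fun p t => p.1.2 = G t p.2) (fun p => f p.1.1)).
    apply: (@definable_comp_coordinate (X * R * R * R) (R * R * R) _ _
            (fun p => ((p.2, p.1.2), p.1.1.2)) (fun q => q.2 = G q.1.1 q.1.2)) => //.
    by coordinates_tac.
  by apply: definable_fun_comp => //; coordinates_tac.
by apply: definable_fun_comp => //; coordinates_tac.
Qed.

Lemma definable_fun_add X {cX : coordinates R X} (f g : X -> R) :
  definable_fun f -> definable_fun g -> definable_fun (fun x => f x + g x).
Proof.
apply: definable_fun_app2; apply: definable_polynomial_eq.
  by apply: polynomial_coordinate; coordinates_tac.
by apply: polynomial_add; apply: polynomial_coordinate; coordinates_tac.
Qed.

Lemma definable_fun_mul X {cX : coordinates R X} (f g : X -> R) :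
  definable_fun f -> definable_fun g -> definable_fun (fun x => f x * g x).
Proof.
apply: definable_fun_app2; apply: definable_polynomial_eq.
  by apply: polynomial_coordinate; coordinates_tac.
by apply: polynomial_mul; apply: polynomial_coordinate; coordinates_tac.
Qed.

Lemma definable_fun_opp X {cX : coordinates R X} (f : X -> R) :
  definable_fun f -> definable_fun (fun x => - f x).
Proof.
move=> df; apply: (@definable_funE _ _ _ (fun x => -1 * f x)).
  by move=> x; rewrite mulN1r.
by apply: definable_fun_mul => //; apply: definable_fun_cst.
Qed.

Lemma definable_fun_sub X {cX : coordinates R X} (f g : X -> R) :
  definable_fun f -> definable_fun g -> definable_fun (fun x => f x - g x).
Proof. by move=> df dg; apply: definable_fun_add => //; apply: definable_fun_opp. Qed.

Lemma definable_fun_sum X {cX : coordinates R X} (T : Type) (r : seq T)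
    (P : pred T) (f : T -> X -> R) :
  (forall t, definable_fun (f t)) ->
  definable_fun (fun x => \sum_(t <- r | P t) f t x).
Proof.
move=> df; elim: r => [|t r IH].
  by apply: (definable_funE (g := fun=> 0)) (definable_fun_cst _) => x; rewrite big_nil.
apply: (@definable_funE _ _ _
  (fun x => (if P t then 1 else 0) * f t x + \sum_(t <- r | P t) f t x)).
  by move=> x; rewrite big_cons; case: ifP; rewrite ?mul1r // mul0r add0r.
apply: definable_fun_add => //; apply: definable_fun_mul => //.
exact: definable_fun_cst.
Qed.

Lemma definable_le X {cX : coordinates R X} (f g : X -> R) :
  definable_fun f -> definable_fun g -> definable_set (fun x => f x <= g x).
Proof.
move=> df dg.
(* Only polynomial equations are given as definable, so the order is recovered from squares. *)
apply: (@definable_setE _ _ _ (fun x => exists c, g x = f x + c * c)).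
  move=> x; split => [fg|[c ->]]; last by rewrite lerDl -expr2 sqr_ge0.
  exists (Num.sqrt (g x - f x)).
  by rewrite -expr2 sqr_sqrtr ?subr_ge0 // addrC subrK.
apply: definable_ex; apply: definable_eq.
  by apply: definable_fun_comp dg; coordinates_tac.
apply: definable_fun_add; first by apply: definable_fun_comp df; coordinates_tac.
by apply: definable_fun_mul; apply: definable_fun_coordinate; coordinates_tac.
Qed.

Lemma definable_lt X {cX : coordinates R X} (f g : X -> R) :
  definable_fun f -> definable_fun g -> definable_set (fun x => f x < g x).
Proof.
move=> df dg; apply: (@definable_setE _ _ _ (fun x => ~ g x <= f x)).
  by move=> x; rewrite ltNge; split => /negP.
exact/definable_not/definable_le.
Qed.

Lemma definable_fun_if X {cX : coordinates R X} (b : X -> bool) (f g : X -> R) :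
  definable_set (fun x => b x) -> definable_fun f -> definable_fun g ->
  definable_fun (fun x => if b x then f x else g x).
Proof.
move=> db df dg.
apply: (@definable_fun_graph _ _
          (fun x t => (b x -> t = f x) /\ (~ b x -> t = g x))).
  move=> x t; case: (b x); split => [[p q]|->]; try by split.
    exact: p.
  exact: q.
have dbp : definable_set (fun p : X * R => b p.1).
  by apply: (definable_comp_coordinate _ db); coordinates_tac.
apply: definable_and; apply: definable_imp => //.
exact: definable_not.
Qed.

Lemma definable_fun_inv X {cX : coordinates R X} (f : X -> R) :
  definable_fun f -> definable_fun (fun x => (f x)^-1).
Proof.
(* The clause for [f x = 0] records the convention that the inverse of 0 is 0. *)
move=> df; apply: (@definable_fun_graph _ _
    (fun x t => (f x = 0 -> t = 0) /\ (f x <> 0 -> f x * t = 1))).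
  move=> x t; have [->|fx0] := eqVneq (f x) 0.
    by rewrite invr0; split => [[-> //]|->].
  split => [[_ ft]|->]; last first.
    by split => [/eqP|]; rewrite ?(negPf fx0) // divff.
  by apply: (mulfI fx0); rewrite ft ?divff //; apply/eqP.
have d1 : definable_fun (fun p : X * R => f p.1).
  by apply: definable_fun_comp df; coordinates_tac.
have d2 : definable_fun (fun p : X * R => p.2).
  by apply: definable_fun_coordinate; coordinates_tac.
have d0 : definable_fun (fun _ : X * R => 0) by exact: definable_fun_cst.
have e0 : definable_set (fun p : X * R => f p.1 = 0) := definable_eq d1 d0.
apply: definable_and; apply: definable_imp => //.
- exact: definable_eq.
- exact: definable_not.
- by apply: definable_eq; [exact: definable_fun_mul | exact: definable_fun_cst].
Qed.

Lemma definable_fun_sqrt X {cX : coordinates R X} (f : X -> R) :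
  definable_fun f -> definable_fun (fun x => Num.sqrt (f x)).
Proof.
(* The clause for [f x < 0] records that [Num.sqrt] is 0 on negative numbers. *)
move=> df; apply: (@definable_fun_graph _ _
    (fun x t => 0 <= t /\ ((f x < 0 -> t = 0) /\ (0 <= f x -> t * t = f x)))).
  move=> x t; have [fx0|fx0] := ltP (f x) 0.
    rewrite (ler0_sqrtr (ltW fx0)).
    by split => [[_ [/(_ isT) -> _]] //|->]; split.
  split => [[t0 [_ /(_ isT) <-]]|->].
    by rewrite -expr2 sqrtr_sqr ger0_norm.
  by rewrite sqrtr_ge0 -expr2 sqr_sqrtr.
have d1 : definable_fun (fun p : X * R => f p.1).
  by apply: definable_fun_comp df; coordinates_tac.
have d2 : definable_fun (fun p : X * R => p.2).
  by apply: definable_fun_coordinate; coordinates_tac.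
have d0 : definable_fun (fun _ : X * R => 0) by exact: definable_fun_cst.
apply: definable_and; first exact: definable_le.
apply: definable_and; apply: definable_imp.
- exact: definable_lt.
- exact: definable_eq.
- exact: definable_le.
- by apply: definable_eq => //; apply: definable_fun_mul.
Qed.

Lemma definable_fun_on_definable_fun n (A : set 'rV[R]_n) (f : 'rV[R]_n -> R) :
  D A -> definable_fun f -> definable_fun_on D A f.
Proof.
move=> dA df.
have dA1 : definable_set (fun p : 'rV[R]_n * R => A p.1).
  apply: (@definable_comp_coordinate ('rV[R]_n * R) 'rV[R]_n _ _ fst A) => //.
  by coordinates_tac.
(* The coordinates of ['rV[R]_n * R] are those of ['rV[R]_(n + 1)], so [graph_on A f] is this set by
   conversion. *)
exact: definable_and dA1 df.
Qed.

End Definability.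

(** * Regularized squared distance *)

Section SquaredNorm.
Variables (R : realType) (n : nat).
Implicit Types u v w x y z : 'rV[R]_n.

Definition dot u v : R := \sum_i u 0 i * v 0 i.

Definition sqnorm u : R := dot u u.

Lemma dotC u v : dot u v = dot v u.
Proof. by apply: eq_bigr => i _; rewrite mulrC. Qed.

Lemma dotDl u v w : dot (u + v) w = dot u w + dot v w.
Proof. by rewrite -big_split; apply: eq_bigr => i _; rewrite mxE mulrDl. Qed.

Lemma dotZl a u v : dot (a *: u) v = a * dot u v.
Proof. by rewrite mulr_sumr; apply: eq_bigr => i _; rewrite mxE mulrA. Qed.

Lemma dotNl u v : dot (- u) v = - dot u v.
Proof. by rewrite -scaleN1r dotZl mulN1r. Qed.

Lemma dotDr u v w : dot w (u + v) = dot w u + dot w v.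
Proof. by rewrite ![dot w _]dotC dotDl. Qed.

Lemma dotZr a u v : dot u (a *: v) = a * dot u v.
Proof. by rewrite ![dot u _]dotC dotZl. Qed.

Lemma dotNr u v : dot u (- v) = - dot u v.
Proof. by rewrite ![dot u _]dotC dotNl. Qed.

Definition dotE := (dotDl, dotDr, dotZl, dotZr, dotNl, dotNr).

Lemma sqnorm_ge0 u : 0 <= sqnorm u.
Proof. by apply: sumr_ge0 => i _; rewrite -expr2 sqr_ge0. Qed.

Lemma sqnorm_eq0 u : sqnorm u = 0 -> u = 0.
Proof.
move=> /eqP; rewrite psumr_eq0; last by move=> i _; rewrite -expr2 sqr_ge0.
move=> /allP u0; apply/rowP => i; rewrite mxE.
by have := u0 i; rewrite mem_index_enum mulf_eq0 orbb => /(_ isT)/eqP.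
Qed.

Lemma sqnormD u v : sqnorm (u + v) = sqnorm u + 2 * dot u v + sqnorm v.
Proof. by rewrite /sqnorm !dotE (dotC v u); ring. Qed.

Lemma sqnormN u : sqnorm (- u) = sqnorm u.
Proof. by rewrite /sqnorm !dotE opprK. Qed.

Lemma sqnormZ a u : sqnorm (a *: u) = a ^+ 2 * sqnorm u.
Proof. by rewrite /sqnorm !dotE; ring. Qed.

Lemma sqnormB u v : sqnorm (u - v) = sqnorm u - 2 * dot u v + sqnorm v.
Proof. by rewrite sqnormD sqnormN dotNr; ring. Qed.

Lemma sqnorm0 : sqnorm 0 = 0.
Proof. by rewrite -(scale0r 0) sqnormZ expr0n mul0r. Qed.

Lemma sqnorm_distC u v : sqnorm (u - v) = sqnorm (v - u).
Proof. by rewrite -sqnormN opprB. Qed.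

Lemma sqr_coord_le_sqnorm u i : u 0 i ^+ 2 <= sqnorm u.
Proof.
rewrite /sqnorm /dot (bigD1 i) //= -expr2 lerDl.
by apply: sumr_ge0 => j _; rewrite -expr2 sqr_ge0.
Qed.

(** Young's inequality, from expanding [sqnorm (a *: u - v)]. With a suitable weight it replaces
    Cauchy-Schwarz in most estimates below and keeps them free of square roots. *)
Lemma dot_le_weighted (a : R) u v :
  0 < a -> 2 * dot u v <= a * sqnorm u + a^-1 * sqnorm v.
Proof.
move=> a0; have := sqnorm_ge0 (a *: u - v).
rewrite sqnormB sqnormZ dotZl => H.
rewrite -subr_ge0 -(pmulr_rge0 _ a0).
have -> : a * (a * sqnorm u + a^-1 * sqnorm v - 2 * dot u v) =
  a ^+ 2 * sqnorm u - 2 * (a * dot u v) + sqnorm v by field; rewrite gt_eqF.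
by [].
Qed.

Lemma sqnormD_le2 u v : sqnorm (u + v) <= 2 * (sqnorm u + sqnorm v).
Proof.
by have := @dot_le_weighted 1 u v ltr01; rewrite sqnormD invr1; lra.
Qed.

Lemma continuous_sqnormB x : continuous (fun y : 'rV[R]_n => sqnorm (y - x)).
Proof.
apply: continuous_big => [|i _ y]; first exact: add_continuous.
have ci : (fun z : 'rV[R]_n => (z - x) 0 i) @ y --> (y - x) 0 i.
  have -> : (fun z : 'rV[R]_n => (z - x) 0 i) = fun z => z 0 i - x 0 i.
    by apply/funext => z; rewrite !mxE.
  rewrite !mxE; exact: (cvgB (@coord_continuous _ _ _ 0 i y) (cvg_cst _)).
exact: (cvgM ci ci).
Qed.

Lemma near_sqnorm x (e : R) : 0 < e -> \forall y \near x, sqnorm (y - x) < e.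
Proof.
move=> e0; have : sqnorm (x - x) < e by rewrite subrr sqnorm0.
by move=> h; apply: (cvgr_lt _ (@continuous_sqnormB x x)).
Qed.

(** Passes from a local Lipschitz estimate in squared euclidean form to the sup-norm topology of the
    library. *)
Lemma continuous_sqnorm_bound (f : 'rV[R]_n -> R) x (C : R) :
  (forall y, sqnorm (y - x) <= 1 -> (f y - f x) ^+ 2 <= C * sqnorm (y - x)) ->
  {for x, continuous f}.
Proof.
move=> fC; apply/(@cvgrPdist_le _ _ _ (nbhs x) (nbhs_filter x)) => e e0.
have C0 : 0 < `|C| + 1 by rewrite ltr_wpDl.
have d0 : 0 < e ^+ 2 / (`|C| + 1) by rewrite divr_gt0 ?exprn_gt0.
near=> y.
have y1 : sqnorm (y - x) < 1 by near: y; exact: near_sqnorm.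
have yd : sqnorm (y - x) < e ^+ 2 / (`|C| + 1) by near: y; exact: near_sqnorm.
rewrite distrC -ler_sqr ?nnegrE ?(ltW e0) // real_normK ?num_real //.
apply: le_trans (fC _ (ltW y1)) _.
move: yd; rewrite ltr_pdivlMr // => yd; apply: le_trans (ltW yd).
have := sqnorm_ge0 (y - x); have := ler_norm C; nra.
Unshelve. all: by end_near. Qed.

(** A quadratic remainder, divided by [h], tends to 0. Derivatives are obtained this way from
    two-sided Taylor inequalities. *)
Lemma is_derive_sqr_bound (V : normedModType R) (f : V -> R) (x v : V) (d K : R) :
  (forall h, `|f (h *: v + x) - f x - h * d| <= K * h ^+ 2) ->
  is_derive x v f d.
Proof.
move=> fK.
have c : (fun h => h^-1 *: ((f \o shift x) (h *: v) - f x)) @ 0^' --> d.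
  apply/cvgrPdist_le => e e0.
  have K0 : 0 < `|K| + 1 by rewrite ltr_wpDl.
  have d0 : 0 < e / (`|K| + 1) by rewrite divr_gt0.
  near=> h.
  have h0 : h != 0 by near: h; exact: nbhs_dnbhs_neq.
  have hd : `|h| < e / (`|K| + 1).
    by near: h; apply: dnbhs0_lt.
  have ah : 0 < `|h| by rewrite normr_gt0.
  rewrite /= -(ler_pM2l ah) -normrM mulrBr /GRing.scale /= mulrA divff // mul1r.
  rewrite distrC; apply: le_trans (fK h) _.
  move: hd; rewrite ltr_pdivlMr // => hd.
  have -> : h ^+ 2 = `|h| * `|h| by rewrite -expr2 real_normK ?num_real.
  have := ler_norm K; nra.
by split; [apply: cvgP c | apply: cvg_lim c].
Unshelve. all: by end_near. Qed.

End SquaredNorm.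

Section RegularizedDistance.
Variables (R : realType) (n : nat) (F : set 'rV[R]_n).
Implicit Types x y z w : 'rV[R]_n.

Definition sqdist z : R := inf [set sqnorm (z - y) | y in F].

Hypothesis F_nonempty : F !=set0.

Lemma sqdist_le z y : F y -> sqdist z <= sqnorm (z - y).
Proof.
move=> Fy; apply: ge_inf; last by exists y.
by exists 0 => _ [w _ <-]; exact: sqnorm_ge0.
Qed.

Lemma le_sqdist z c : (forall y, F y -> c <= sqnorm (z - y)) -> c <= sqdist z.
Proof.
move=> cF; apply: lb_le_inf; last by move=> _ [y Fy <-]; exact: cF.
by case: F_nonempty => y Fy; exists (sqnorm (z - y)), y.
Qed.

Lemma sqdist_ge0 z : 0 <= sqdist z.
Proof. by apply: le_sqdist => y _; exact: sqnorm_ge0. Qed.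

(** For a single [y] in [F] this is the parallelogram identity, with equality. Taking the infimum
    over [y] gives midpoint concavity of [sqdist z - sqnorm z], which is an infimum of affine
    functions. *)
Lemma sqdist_midpoint z w :
  2^-1 * (sqdist z + sqdist w) - 4^-1 * sqnorm (z - w) <= sqdist (2^-1 *: (z + w)).
Proof.
apply: le_sqdist => y Fy.
have := sqdist_le z Fy; have := sqdist_le w Fy.
have -> : z - w = (z - y) - (w - y) by rewrite opprB addrA subrK.
have -> : 2^-1 *: (z + w) - y = 2^-1 *: ((z - y) + (w - y)).
  by apply/rowP => i; rewrite !mxE; field.
move: (z - y) (w - y) => a b; rewrite sqnormZ sqnormB sqnormD; lra.
Qed.

(** Squared triangle inequality with a free weight: a small [a] gives continuity, [a = 2] coercivity
    of the penalized problem, [a = 1] the comparison of [lasry_lions] with [sqdist]. *)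
Lemma sqdist_weighted a z w : 0 < a ->
  sqdist w <= (1 + a) * sqdist z + (1 + a^-1) * sqnorm (w - z).
Proof.
move=> a0; have a1 : 0 < 1 + a by rewrite addr_gt0.
rewrite -lerBlDr -ler_pdivrMl //; apply: le_sqdist => y Fy.
rewrite ler_pdivrMl // lerBlDr; apply: le_trans (sqdist_le w Fy) _.
have -> : w - y = (z - y) + (w - z) by apply/rowP => i; rewrite !mxE; ring.
have := dot_le_weighted (z - y) (w - z) a0.
move: (z - y) (w - z) => u v; rewrite sqnormD; lra.
Qed.

(* [sqdist_weighted] with [a = |y - x|] makes [sqdist] locally Lipschitz. *)
Lemma continuous_sqdist : continuous sqdist.
Proof.
(* With [s = |y - x| <= 1], one inequality gives [sqdist y <= 2 * sqdist x + 2]; inserted in the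
   other, it bounds the difference by [s * (2 * sqdist x + 4)]. *)
move=> x; apply: (@continuous_sqnorm_bound _ _ _ _ ((2 * sqdist x + 4) ^+ 2)) => y.
set N := sqnorm (y - x) => N1.
have [N0|N0] := eqVneq N 0.
  have /eqP := sqnorm_eq0 N0; rewrite subr_eq0 => /eqP ->.
  by rewrite subrr expr0n N0 mulr0.
have Np : 0 < N by rewrite lt_def N0 sqnorm_ge0.
set s := Num.sqrt N.
have s0 : 0 < s by rewrite sqrtr_gt0.
have ss : s ^+ 2 = N by rewrite sqr_sqrtr ?ltW.
have s1 : s <= 1 by rewrite leNgt; apply/negP => s1; move: N1; rewrite -ss; nra.
have sN : (1 + s^-1) * N = s ^+ 2 + s.
  by rewrite -ss; field; rewrite gt_eqF.
have := sqdist_weighted x y s0; have := sqdist_weighted y x s0.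
rewrite (sqnorm_distC x y) -/N sN.
have := sqdist_ge0 x; have := sqdist_ge0 y.
move: (sqdist x) (sqdist y) => a b b0 a0 H1 H2.
rewrite -ss -exprMn -ler_sqrt ?exprn_ge0 //; last nra.
rewrite !sqrtr_sqr ler_norml (@ger0_norm _ (_ * s)); last nra.
by apply/andP; split; nra.
Qed.

Definition penalized x z : R := sqdist z - 2 * sqnorm (x - z).

Lemma continuous_penalized x : continuous (penalized x).
Proof.
move=> z; rewrite /penalized.
under eq_fun do rewrite sqnorm_distC.
have c2 : (fun w => 2 * sqnorm (w - x)) @ z --> 2 * sqnorm (z - x).
  exact: (cvgMl_tmp (@continuous_sqnormB _ _ x z)).
exact: (cvgB (@continuous_sqdist z) c2).
Qed.

(** The weight 2 produces the coefficient 3/2, which the penalty 2 beats. The remaining 1/2 yields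
    both the existence of a maximizer and the bound on the gradient. *)
Lemma penalized_bound x z : penalized x z <= 3 * sqdist x - 2^-1 * sqnorm (x - z).
Proof.
have := @sqdist_weighted 2 x z (ltr0Sn _ 1); rewrite /penalized (sqnorm_distC z x); lra.
Qed.

Lemma penalized_max x : exists z, forall w, penalized x w <= penalized x z.
Proof.
(* Outside the cube of half-side [r] one has [sqnorm (x - z) >= r ^+ 2 >= 4 * sqdist x], so
   [penalized_bound] falls to at most [sqdist x = penalized x x], and the maximum over the cube is
   global. *)
set r := 4 * sqdist x + 1.
have g0 := sqdist_ge0 x.
set A := [set z : 'rV[R]_n | forall i, `[x 0 i - r, x 0 i + r]%classic (z ord0 i)].
have cA : compact A.
  by apply: (rV_compact (A := fun i => `[x 0 i - r, x 0 i + r]%classic)) => i;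
    exact: segment_compact.
have Ax : A x by move=> i /=; rewrite in_itv /=; apply/andP; rewrite /r; split; lra.
have [||z zA zmax] := @EVT_max_rV _ _ (penalized x) A _ cA.
- by exists x.
- by apply: continuous_subspaceT; exact: continuous_penalized.
exists z => w; have [Aw|nAw] := pselect (A w); first by apply: zmax; rewrite inE.
have xz := zmax x (mem_set Ax); apply: le_trans xz.
have xx : penalized x x = sqdist x.
  by rewrite /penalized subrr sqnorm0 mulr0 subr0.
rewrite xx; apply: le_trans (penalized_bound x w) _.
have [i xi] : exists i, ~ `[x 0 i - r, x 0 i + r]%classic (w ord0 i).
  by apply/existsNP.
have := sqr_coord_le_sqnorm (x - w) i; rewrite !mxE.
suff : 4 * sqdist x <= (x 0 i - w 0 i) ^+ 2 by lra.
have [lt1|ge1] := ltP (w 0 i) (x 0 i - r).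
  by rewrite /r in lt1; nra.
have [lt2|ge2] := ltP (x 0 i + r) (w 0 i).
  by rewrite /r in lt2; nra.
by case: xi; rewrite /= in_itv /= ge1 ge2.
Qed.

Definition argmax x : 'rV[R]_n := sval (cid (penalized_max x)).

Definition lasry_lions x : R := penalized x (argmax x).

Lemma penalized_le x z : penalized x z <= lasry_lions x.
Proof. exact: (svalP (cid (penalized_max x))). Qed.

(* The midpoint inequality for [sqdist] makes [penalized x] strongly concave. *)
Lemma penalized_strong x z :
  penalized x z + 2^-1 * sqnorm (argmax x - z) <= lasry_lions x.
Proof.
have := penalized_le x (2^-1 *: (argmax x + z)).
have := sqdist_midpoint (argmax x) z.
rewrite /lasry_lions /penalized.
have -> : argmax x - z = (x - z) - (x - argmax x) 
  by apply/rowP => i; rewrite !mxE; ring.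
have -> : x - 2^-1 *: (argmax x + z) = 2^-1 *: ((x - argmax x) + (x - z)).
  by apply/rowP => i; rewrite !mxE; field.
move: (x - argmax x) (x - z) => a b; rewrite sqnormZ sqnormB sqnormD (dotC b); lra.
Qed.

(** Adding the strong concavity inequalities at [x] and at [y] cancels all values of [sqdist] and
    leaves the squared distance of the maximizers at most 4 times the dot product of [x - y] with
    their difference; Young's inequality with weight 4 absorbs half of it. *)
Lemma argmax_lipschitz x y : sqnorm (argmax x - argmax y) <= 16 * sqnorm (x - y).
Proof.
have := penalized_strong x (argmax y); have := penalized_strong y (argmax x).
rewrite /lasry_lions /penalized (sqnorm_distC (argmax y)).
set z := argmax x; set w := argmax y.
have e : 2 * sqnorm (x - w) - 2 * sqnorm (x - z) + 2 * sqnorm (y - z)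
    - 2 * sqnorm (y - w) = 2 * (2 * dot (x - y) (z - w)).
  rewrite !sqnormB !dotE; ring.
have := @dot_le_weighted _ _ 4 (x - y) (z - w) (ltr0Sn _ 3); lra.
Qed.

(** Envelope theorem: the gradient in [x] of [penalized x z] with [z] frozen at [argmax x]. *)
Definition lasry_lions_grad x : 'rV[R]_n := 4 *: (argmax x - x).

(** The maximizer for [x] is a competitor for [y], and the penalty is exactly quadratic. *)
Lemma lasry_lions_lower x y :
  lasry_lions x + dot (lasry_lions_grad x) (y - x) - 2 * sqnorm (y - x) <= lasry_lions y.
Proof.
apply: le_trans (penalized_le y (argmax x)); rewrite /lasry_lions /penalized dotZl.
have -> : y - argmax x = (y - x) - (argmax x - x) by rewrite opprB addrA subrK.
rewrite (sqnorm_distC x); move: (y - x) (argmax x - x) => a b.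
by rewrite sqnormB (dotC a); lra.
Qed.

(** The lower bound with [x] and [y] exchanged has the gradient at [y] and the constant 2. Moving
    the gradient to [x] costs 16 through [argmax_lipschitz] and gains 4, hence 14. *)
Lemma lasry_lions_upper x y :
  lasry_lions y <= lasry_lions x + dot (lasry_lions_grad x) (y - x) + 14 * sqnorm (y - x).
Proof.
have := lasry_lions_lower y x; have := argmax_lipschitz y x.
have := @dot_le_weighted _ _ 4^-1 (argmax y - argmax x) (y - x).
rewrite invr_gt0 invrK ltr0Sn => /(_ isT).
rewrite (sqnorm_distC x) /lasry_lions_grad !dotZl -(opprB y x) dotNr.
have -> : argmax y - y = (argmax y - argmax x) + (argmax x - x) - (y - x).
  by apply/rowP => i; rewrite !mxE; ring.
move: (argmax y - argmax x) (argmax x - x) (y - x) => a b c.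
rewrite !(dotDl, dotNl) -/(sqnorm c); lra.
Qed.

Lemma is_derive_lasry_lions x i :
  is_derive x (delta_mx 0 i) lasry_lions (lasry_lions_grad x 0 i).
Proof.
apply: (@is_derive_sqr_bound _ _ _ _ _ _ 14) => h.
have := lasry_lions_lower x (h *: delta_mx 0 i + x).
have := lasry_lions_upper x (h *: delta_mx 0 i + x).
have d1 v : dot v (delta_mx 0 i) = v 0 i.
  rewrite /dot (bigD1 i) //= mxE !eqxx mulr1 big1 ?addr0 // => j ji.
  by rewrite mxE (negPf ji) andbF mulr0.
have d2 : sqnorm (delta_mx 0 i : 'rV[R]_n) = 1 by rewrite /sqnorm d1 mxE !eqxx.
rewrite addrK sqnormZ dotZr d1 d2 ler_norml => H1 H2.
by apply/andP; split; have := sqr_ge0 h; nra.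
Qed.

Lemma continuous_lasry_lions_grad i : continuous (fun x => lasry_lions_grad x 0 i).
Proof.
(* 544 is 32 * (16 + 1), from [(4 * (a - b)) ^+ 2 <= 32 * (a ^+ 2 + b ^+ 2)] and
   [argmax_lipschitz]. *)
move=> x; apply: (@continuous_sqnorm_bound _ _ _ _ 544) => y _.
have -> : lasry_lions_grad y 0 i - lasry_lions_grad x 0 i =
    4 * ((argmax y - argmax x) 0 i - (y - x) 0 i) by rewrite !mxE; ring.
have := sqr_coord_le_sqnorm (argmax y - argmax x) i.
have := sqr_coord_le_sqnorm (y - x) i; have := argmax_lipschitz y x.
by move: (_ 0 i) (_ 0 i) => a b; have := sqr_ge0 (a + b); nra.
Qed.

Lemma sqdist_le_lasry_lions x : sqdist x <= lasry_lions x.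
Proof.
have := penalized_le x x.
by rewrite /penalized subrr sqnorm0 mulr0 subr0.
Qed.

Lemma lasry_lions_le x : lasry_lions x <= 2 * sqdist x.
Proof.
have := @sqdist_weighted 1 x (argmax x) ltr01.
by rewrite /lasry_lions /penalized (sqnorm_distC x) invr1; lra.
Qed.

(** At the maximizer, [penalized_bound] and [sqdist x <= lasry_lions x] give [sqnorm (x - argmax x)
    <= 4 * lasry_lions x]; the factor 4 in the gradient contributes 16. *)
Lemma sqnorm_lasry_lions_grad x : sqnorm (lasry_lions_grad x) <= 64 * lasry_lions x.
Proof.
have := sqdist_le_lasry_lions x; have := penalized_bound x (argmax x).
rewrite sqnormZ -/(lasry_lions x) (sqnorm_distC x); lra.
Qed.

Lemma continuous_lasry_lions : continuous lasry_lions.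
Proof.
(* The increment is [d + e] with [d] linear and [|e| <= 14 * N]; since [N <= 1],
   [2 * e ^+ 2 <= 392 * N], and Cauchy-Schwarz controls [d]. *)
move=> x; apply: (@continuous_sqnorm_bound _ _ _ _
  (2 * sqnorm (lasry_lions_grad x) + 392)) => y.
have := lasry_lions_lower x y; have := lasry_lions_upper x y.
set N := sqnorm (y - x) => H1 H2 N1.
set G := lasry_lions_grad x in H1 H2 *; set d := dot G (y - x) in H1 H2.
have N0 : 0 <= N := sqnorm_ge0 _.
have CS : d ^+ 2 <= sqnorm G * N.
  have [N00|N00] := eqVneq N 0.
    by rewrite /d (sqnorm_eq0 N00) dotC -(scale0r 0) dotZl mul0r expr0n N00 mulr0.
  have Np : 0 < N by rewrite lt_def N00.
  have := sqnorm_ge0 (G - (d / N) *: (y - x)).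
  rewrite sqnormB sqnormZ dotZr -/d -/N => H.
  rewrite -subr_ge0 -(pmulr_lge0 _ (x := N^-1)) ?invr_gt0 //.
  have -> : (sqnorm G * N - d ^+ 2) / N =
    sqnorm G - 2 * (d / N * d) + (d / N) ^+ 2 * N by field; rewrite gt_eqF.
  by [].
have := sqnorm_ge0 G; move: (sqnorm G) CS => g CS g0.
have [e [He1 [He2 ->]]] : exists e, e <= 14 * N /\ - (14 * N) <= e /\
    lasry_lions y - lasry_lions x = d + e.
  exists (lasry_lions y - lasry_lions x - d); by split; [|split]; lra.
have e2 : e ^+ 2 <= 196 * N by nra.
have := sqr_ge0 (d - e); nra.
Qed.

Lemma lasry_lions_eq0 x : lasry_lions x = 0 <-> closure F x.
Proof.
have g0 := sqdist_ge0 x; have h1 := sqdist_le_lasry_lions x.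
have h2 := lasry_lions_le x.
split=> [hx|cFx].
  have {g0 h1 h2 hx} gx : sqdist x = 0 by lra.
  apply: contrapT => nc.
  have [e e0 eF] : exists2 e : R, 0 < e & forall y, F y -> e <= sqnorm (x - y).
    have /existsNP[B /not_implyP[Bx /set0P/negP]] := nc.
    rewrite negbK => /eqP BF0.
    have /nbhs_ballP[e /= e0 eB] := Bx.
    exists (e ^+ 2) => [|y Fy]; first by rewrite exprn_gt0.
    rewrite leNgt; apply/negP => xy.
    have : (F `&` B) y.
      split => //; apply: eB; rewrite -ball_normE /=.
      rewrite -[`|x - y|]/(mx_norm (x - y)).
      (* A nonzero sup norm is attained at some coordinate, whose square is at most [sqnorm]. *)
      have [->//|/mx_norm_neq0 [[i0 i] /= ->]] := eqVneq (mx_norm (x - y)) 0.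
      rewrite ord1.
      rewrite -ltr_sqr ?nnegrE ?(ltW e0) // real_normK ?num_real //.
      exact: le_lt_trans (sqr_coord_le_sqnorm _ _) xy.
    by rewrite BF0.
  by have := le_sqdist eF; rewrite gx leNgt e0.
apply: le_anti; rewrite (le_trans g0 h1) andbT.
rewrite leNgt; apply/negP => hx.
have /(near_sqnorm x)/cFx [y [Fy /=]] : 0 < 2^-1 * lasry_lions x by lra.
have := sqdist_le x Fy; rewrite sqnorm_distC; lra.
Qed.

End RegularizedDistance.

Section DefinableDistance.
Variables (R : realType) (D : forall n : nat, set (set 'rV[R]_n)).
Hypothesis D_omin : ominimal_structure D.

Lemma definable_fun_sqnormB X {cX : coordinates R X} n (u v : X -> 'rV[R]_n) :
  coordinate_map u -> coordinate_map v ->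
  definable_fun D (fun x => sqnorm (u x - v x)).
Proof.
move=> cu cv; apply: definable_fun_sum => // i.
apply: (@definable_funE _ _ _ _ _
  (fun x => (u x 0 i - v x 0 i) * (u x 0 i - v x 0 i))).
  by move=> x; rewrite !mxE.
by apply: definable_fun_mul => //; apply: definable_fun_sub => //;
  apply: definable_fun_coordinate => //; apply: coordinate_entry.
Qed.

Lemma definable_sqdist_lb X {cX : coordinates R X} n (F : set 'rV[R]_n)
    (u : X -> 'rV[R]_n) (c : X -> R) :
  D F -> coordinate_map u -> definable_fun D c ->
  definable_set D (fun x => forall y, F y -> c x <= sqnorm (u x - y)).
Proof.
move=> dF cu dc; apply: definable_all => //; apply: definable_imp => //.
  apply: (@definable_comp_coordinate _ _ D_omin (X * 'rV[R]_n) 'rV[R]_n _ _ snd F) => //.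
  by coordinates_tac.
apply: definable_le => //.
  by apply: definable_fun_comp dc => //; coordinates_tac.
apply: definable_fun_sqnormB; last by coordinates_tac.
case: cu => s us; exists (fun j => lshift _ (s j)) => -[x y] j.
by rewrite us /= row_mxEl.
Qed.

Lemma definable_sqdist n (F : set 'rV[R]_n) :
  F !=set0 -> D F -> definable_fun D (sqdist F).
Proof.
(* The infimum is described in first-order terms as the greatest lower bound. *)
move=> F0 dF.
apply: (@definable_fun_graph _ _ _ _ (fun z t =>
  (forall y, F y -> t <= sqnorm (z - y)) /\
  forall c, (forall y, F y -> c <= sqnorm (z - y)) -> c <= t)).
  move=> z t; split => [[tF tmax]|->].
    apply/le_anti; rewrite le_sqdist //=.
    by apply: tmax => y; exact: sqdist_le.
  by split => [y|c]; [exact: sqdist_le|exact: le_sqdist].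
apply: definable_and => //.
  apply: definable_sqdist_lb => //; first by coordinates_tac.
  by apply: definable_fun_coordinate => //; coordinates_tac.
apply: definable_all => //; apply: definable_imp => //.
  apply: definable_sqdist_lb => //; first by coordinates_tac.
  by apply: definable_fun_coordinate => //; coordinates_tac.
by apply: definable_le => //; apply: definable_fun_coordinate => //; coordinates_tac.
Qed.

Lemma definable_lasry_lions n (F : set 'rV[R]_n) (F0 : F !=set0) :
  D F -> definable_fun D (lasry_lions F0).
Proof.
move=> dF; have dg := definable_sqdist F0 dF.
have dp (X : Type) (cX : coordinates R X) (u v : X -> 'rV[R]_n) :
    coordinate_map u -> coordinate_map v ->
    definable_fun D (fun x => penalized F (u x) (v x)).
  move=> cu cv; apply: definable_fun_sub => //; first exact: definable_fun_comp.
  apply: definable_fun_mul => //; first exact: definable_fun_cst.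
  exact: definable_fun_sqnormB.
apply: (@definable_fun_graph _ _ _ _ (fun x t =>
  (forall z, penalized F x z <= t) /\ exists z, penalized F x z = t)).
  move=> x t; split => [[tmax [z zt]]|->].
    by apply/le_anti; rewrite tmax -zt penalized_le.
  by split => [z|]; [exact: penalized_le | exists (argmax F0 x)].
apply: definable_and => //.
  apply: definable_all => //; apply: definable_le => //.
    by apply: dp; coordinates_tac.
  by apply: definable_fun_coordinate => //; coordinates_tac.
apply: definable_ex => //; apply: definable_eq => //.
  by apply: dp; coordinates_tac.
by apply: definable_fun_coordinate => //; coordinates_tac.
Qed.

(* Bounds by [1 / d(x, P)^2] are stated through lower bounds of [d(x, P)^2]: this
   avoids the junk value [inf set0 = 0] and is monotone in [P]. *)
Definition sqdist_lower_bound n (P : set 'rV[R]_n) (x : 'rV[R]_n) (rho : R) : Prop :=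
  forall y, P y -> rho <= sqnorm (x - y).

Lemma regularized_sqdist n (F : set 'rV[R]_n) : D F ->
  exists (h : 'rV[R]_n -> R) (G : 'rV[R]_n -> 'rV[R]_n),
  [/\ definable_fun D h /\ (forall x, 0 <= h x),
      continuous h /\ (forall i, continuous (fun x => G x 0 i)),
      (forall x i, is_derive x (delta_mx 0 i) h (G x 0 i)) /\
      (forall x, sqnorm (G x) <= 64 * h x),
      (forall x, h x = 0 <-> closure F x) &
      (forall x y, F y -> h x <= 2 * sqnorm (x - y)) /\
      (F !=set0 -> forall x rho, sqdist_lower_bound F x rho -> rho <= h x)].
Proof.
move=> dF; have [->|F0] := eqVneq F set0.
  (* For empty [F] a positive constant serves: its zero set is the empty closure, and the upper
     bound by distances is vacuous. *)
  exists (fun=> 1), (fun=> 0); split.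
  - by split => [|x]; [exact: definable_fun_cst | exact: ler01].
  - split => [|i] x; exact: cst_continuous.
  - split => [x i|x]; first by rewrite mxE; exact: is_derive_cst.
    by rewrite sqnorm0 mulr_ge0.
  - by move=> x; rewrite closure0; split => // /eqP; rewrite oner_eq0.
  - by split => // -[].
have {}F0 : F !=set0 by apply/set0P.
exists (lasry_lions F0), (lasry_lions_grad F0); split.
- split; first exact: definable_lasry_lions.
  by move=> x; apply: le_trans (sqdist_le_lasry_lions F0 x); exact: sqdist_ge0.
- split; first exact: continuous_lasry_lions.
  exact: continuous_lasry_lions_grad.
- split; first exact: is_derive_lasry_lions.
  exact: sqnorm_lasry_lions_grad.
- exact: lasry_lions_eq0.
- split => [x y Fy|_ x rho rhoF].
    have := lasry_lions_le F0 x; have := sqdist_le x Fy; lra.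
  apply: le_trans (sqdist_le_lasry_lions F0 x).
  exact: le_sqdist.
Qed.

Lemma definable_closure n (F : set 'rV[R]_n) : D F -> D (closure F).
Proof.
move=> /regularized_sqdist [h [G [[dh _] _ _ h0 _]]].
apply: (@definable_setE _ D _ (coordinates_rV R n) (closure F) (fun x => h x = 0)).
  by move=> x; rewrite h0.
by apply: definable_eq => //; exact: definable_fun_cst.
Qed.

End DefinableDistance.

(** * Continuously differentiable functions *)

Section C1Calculus.
Variables (R : realType) (n : nat).
Implicit Types (x y : 'rV[R]_n) (f g : 'rV[R]_n -> R).

Local Notation e_ i := (delta_mx 0 i : 'rV[R]_n).

(** The neighbourhood is left implicit, so that the calculus rules need not track domains. The open
    set required by [Ck_extension] is recovered as the set of all points where this holds. *)
Definition C1_near x f : Prop :=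
  \forall y \near x, {for y, continuous f} /\
    forall i, derivable f y (e_ i) /\ {for y, continuous (fun z => 'D_(e_ i) f z)}.

Lemma near_all x (P : 'rV[R]_n -> Prop) : (forall y, P y) -> \forall y \near x, P y.
Proof. exact: (@filterE _ (nbhs x) (nbhs_filter x)). Qed.

Lemma near_eq_continuous y f g : (\forall z \near y, f z = g z) ->
  {for y, continuous f} -> {for y, continuous g}.
Proof.
move=> fg; rewrite /prop_for /continuous_at /= -(nbhs_singleton fg) => cf.
exact: cvg_trans (near_eq_cvg fg) cf.
Qed.

Lemma C1_nearP x f (G : 'I_n -> 'rV[R]_n -> R) :
  (\forall y \near x, {for y, continuous f} /\
    forall i, is_derive y (e_ i) f (G i y) /\ {for y, continuous (G i)}) ->
  C1_near x f.
Proof.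
move=> /near_join; rewrite /C1_near; apply: filterS => y Hy.
have [cf Hf] := nbhs_singleton Hy; split=> // i.
have [df cG] := Hf i; split; first exact: ex_derive.
(* The candidate agrees with the derivative on a whole neighbourhood of [y], so its continuity
   transfers. *)
have eqD : \forall z \near y, G i z = 'D_(e_ i) f z.
  by apply: filterS Hy => z [_ /(_ i)[dfz _]]; rewrite derive_val.
exact: near_eq_continuous eqD cG.
Qed.

Lemma C1_near_eq x f g : (\forall y \near x, f y = g y) -> C1_near x f -> C1_near x g.
Proof.
move=> fg Cf.
apply: (@C1_nearP _ _ (fun i y => 'D_(e_ i) f y)).
have := near_join fg; move: Cf; apply: filterS2 => y [cf Hf] fgy; split.
  exact: near_eq_continuous fgy cf.
move=> i; have [df cD] := Hf i; split; last exact: cD.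
exact: near_eq_is_derive fgy (DeriveDef df erefl).
Qed.

Lemma C1_near_derivable x f i : C1_near x f -> derivable f x (e_ i).
Proof. by move=> /nbhs_singleton[_ /(_ i)[]]. Qed.

Lemma C1_near_near x f : C1_near x f -> \forall y \near x, C1_near y f.
Proof. exact: near_join. Qed.

Lemma C1_near_continuous x f : C1_near x f -> {for x, continuous f}.
Proof. by move=> /nbhs_singleton[]. Qed.

Lemma C1_near_cst x (c : R) : C1_near x (fun=> c).
Proof.
apply: (@C1_nearP _ _ (fun i y => 0)); apply: near_all => y; split => [|i].
  exact: cst_continuous.
by split; [exact: is_derive_cst | exact: cst_continuous].
Qed.

Lemma C1_near_add x f g : C1_near x f -> C1_near x g -> C1_near x (fun y => f y + g y).
Proof.
move=> Cf Cg.
apply: (@C1_nearP _ _ (fun i y => 'D_(e_ i) f y + 'D_(e_ i) g y)).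
move: Cf Cg; apply: filterS2 => y [cf Hf] [cg Hg]; split => [|i].
  exact: (cvgD cf cg).
have [df cdf] := Hf i; have [dg cdg] := Hg i; split; last exact: (cvgD cdf cdg).
exact: (is_deriveD (DeriveDef df erefl) (DeriveDef dg erefl)).
Qed.

Lemma C1_near_mul x f g : C1_near x f -> C1_near x g -> C1_near x (fun y => f y * g y).
Proof.
move=> Cf Cg.
apply: (@C1_nearP _ _ (fun i y => f y * 'D_(e_ i) g y + g y * 'D_(e_ i) f y)).
move: Cf Cg; apply: filterS2 => y [cf Hf] [cg Hg]; split => [|i].
  exact: (cvgM cf cg).
have [df cdf] := Hf i; have [dg cdg] := Hg i; split.
  exact: (is_deriveM (DeriveDef df erefl) (DeriveDef dg erefl)).
exact: (cvgD (cvgM cf cdg) (cvgM cg cdf)).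
Qed.

Lemma C1_near_opp x f : C1_near x f -> C1_near x (fun y => - f y).
Proof.
move=> Cf; apply: (@C1_near_eq _ (fun y => -1 * f y)).
  by apply: near_all => y; rewrite mulN1r.
exact: (C1_near_mul (C1_near_cst _ _) Cf).
Qed.

Lemma C1_near_sub x f g : C1_near x f -> C1_near x g -> C1_near x (fun y => f y - g y).
Proof. move=> Cf Cg; exact: (C1_near_add Cf (C1_near_opp Cg)). Qed.

Lemma C1_near_sum x (T : Type) (r : seq T) (P : pred T) (f : T -> 'rV[R]_n -> R) :
  (forall t, P t -> C1_near x (f t)) -> C1_near x (fun y => \sum_(t <- r | P t) f t y).
Proof.
move=> Cf; elim: r => [|t r IH].
  apply: C1_near_eq (C1_near_cst x 0); apply: near_all => y; by rewrite big_nil.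
apply: (@C1_near_eq _ (fun y => (if P t then f t y else 0) + \sum_(t <- r | P t) f t y)).
  by apply: near_all => y; rewrite big_cons; case: ifP => //; rewrite add0r.
apply: C1_near_add; last exact: IH.
case Pt: (P t); first exact: Cf.
exact: C1_near_cst.
Qed.

Lemma is_derive_chain (t : R -> R) f x v a b :
  is_derive (f x) 1 t a -> is_derive x v f b -> is_derive x v (t \o f) (a * b).
Proof.
(* Restriction to the line through [x] in direction [v] reduces the claim to the chain rule in one
   variable. *)
have line (g : 'rV[R]_n -> R) c :
    is_derive x v g c <-> is_derive (0 : R) 1 (fun h => g (h *: v + x)) c.
  have e : 'D_v g x = 'D_1 (fun h : R => g (h *: v + x)) 0.
    have eqf : (fun h : R => h^-1 *: ((g \o shift x) (h *: v) - g x)) =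
        (fun h : R => h^-1 *: (((fun h : R => g (h *: v + x)) \o shift 0) (h *: 1)
                               - g (0 *: v + x))).
      by apply/funext => h; rewrite /= scale0r add0r addr0 [h *: 1]mulr1.
    by rewrite /derive eqf.
  split => -[dg <-].
    by apply: DeriveDef; [exact: (derivable1P g x v).1 | rewrite e].
  by apply: DeriveDef; [exact: (derivable1P g x v).2 | rewrite e].
move=> dt /line df; apply/line.
apply: (is_derive1_comp (f := t) (g := fun h : R => f (h *: v + x))) => //.
by rewrite scale0r add0r.
Qed.

Lemma C1_near_comp x f (t t' : R -> R) :
  (forall s : R, is_derive s 1 t (t' s)) -> continuous t' ->
  C1_near x f -> C1_near x (fun y => t (f y)).
Proof.
move=> dt ct' Cf.
apply: (@C1_nearP _ _ (fun i y => t' (f y) * 'D_(e_ i) f y)).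
move: Cf; apply: filterS => y [cf Hf].
have ct : continuous t.
  move=> s; apply: differentiable_continuous; apply/derivable1_diffP.
  by have [] := dt s.
split => [|i]; first exact: (continuous_comp cf (ct _)).
have [df cdf] := Hf i; split.
  exact: is_derive_chain (dt _) (DeriveDef df erefl).
exact: (cvgM (continuous_comp cf (ct' _)) cdf).
Qed.

Lemma C1_near_inv x f : f x != 0 -> C1_near x f -> C1_near x (fun y => (f y)^-1).
Proof.
move=> fx0 Cf.
have f0 : \forall y \near x, f y != 0.
  exact: (cvgr_neq0 _ (C1_near_continuous Cf)).
apply: (@C1_nearP _ _ (fun i y => - (f y) ^- 2 * 'D_(e_ i) f y)).
move: Cf f0; apply: filterS2 => y [cf Hf] fy0.
split => [|i]; first exact: (cvgV fy0 cf).
have [df cdf] := Hf i; split.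
  by apply: DeriveDef; [exact: derivableV | rewrite deriveV].
have fy20 : f y ^+ 2 != 0 by rewrite expf_neq0.
exact: (cvgM (cvgN (cvgV fy20 (cvgM cf cf))) cdf).
Qed.

Lemma C1_near_Ck_extension (A : set 'rV[R]_n) f :
  (forall x, A x -> C1_near x f) -> Ck_extension 1 A f f.
Proof.
move=> Cf; exists [set x | C1_near x f]; split => //.
  by rewrite openE => x /C1_near_near.
split => [x /= /nbhs_singleton[]//|i]; split => [x /= /nbhs_singleton[_ /(_ i)[]]//|].
by split=> // x /= /nbhs_singleton[_ /(_ i)[]].
Qed.

Lemma gradient_near_eq x f g :
  (\forall y \near x, f y = g y) -> gradient f x = gradient g x.
Proof. by move=> fg; apply/rowP => i; rewrite !mxE; exact: near_eq_derive. Qed.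

Lemma gradient_cst x (c : R) : gradient (fun=> c) x = 0.
Proof. by apply/rowP => i; rewrite !mxE; exact: derive_cst. Qed.

Lemma gradient_mul x f g : C1_near x f -> C1_near x g ->
  gradient (fun y => f y * g y) x = f x *: gradient g x + g x *: gradient f x.
Proof.
move=> Cf Cg; apply/rowP => i; rewrite !mxE.
by apply: deriveM; exact: C1_near_derivable.
Qed.

Lemma gradient_add x f g : C1_near x f -> C1_near x g ->
  gradient (fun y => f y + g y) x = gradient f x + gradient g x.
Proof.
move=> Cf Cg; apply/rowP => i; rewrite !mxE.
by apply: deriveD; exact: C1_near_derivable.
Qed.

Lemma gradient_opp x f : C1_near x f -> gradient (fun y => - f y) x = - gradient f x.
Proof.
by move=> Cf; apply/rowP => i; rewrite !mxE; apply: deriveN; exact: C1_near_derivable.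
Qed.

Lemma sqnorm_gradient_mul x f g (B : R) : C1_near x f -> C1_near x g ->
  0 <= f x <= 1 -> 0 <= g x <= 1 ->
  sqnorm (gradient f x) <= B -> sqnorm (gradient g x) <= B ->
  sqnorm (gradient (fun y => f y * g y) x) <= 4 * B.
Proof.
move=> Cf Cg /andP[f0 f1] /andP[g0 g1] Bf Bg; rewrite gradient_mul //.
apply: le_trans (sqnormD_le2 _ _) _; rewrite !sqnormZ.
have := sqnorm_ge0 (gradient f x); have := sqnorm_ge0 (gradient g x).
have f2 : f x ^+ 2 <= 1 by rewrite expr_le1.
have g2 : g x ^+ 2 <= 1 by rewrite expr_le1.
move=> gg0 gf0.
have := ler_piMl gg0 f2; have := ler_piMl gf0 g2; lra.
Qed.

End C1Calculus.

(** * Cutoff functions *)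

Section FlatCutoff.
Variable R : realType.
Implicit Types s t v x : R.

Definition pos x : R := Num.max 0 x.

Lemma pos_ge x : 0 <= x -> pos x = x.
Proof. by move=> x0; apply/max_idPr. Qed.

Lemma pos_le x : x <= 0 -> pos x = 0.
Proof. by move=> x0; apply/max_idPl. Qed.

Lemma continuous_pos : continuous pos.
Proof.
move=> x; apply: (@continuous_max _ _ (fun=> 0) id x); last exact: cvg_id.
exact: cst_continuous.
Qed.

Lemma is_derive_sqr_pos x : is_derive x 1 (fun t => pos t ^+ 2) (2 * pos x).
Proof.
apply: (@is_derive_sqr_bound _ _ _ _ _ _ 1) => h; rewrite mul1r [h *: 1]mulr1.
rewrite ler_norml.
have [x0|x0] := leP 0 x; have [y0|y0] := leP 0 (h + x);
  rewrite ?(pos_ge x0) ?(pos_ge y0) ?(pos_le (ltW x0)) ?(pos_le (ltW y0));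
  by apply/andP; split; nra.
Qed.

(* The integral of a tent function, which is C^1. *)
Definition step v : R :=
  2 * pos v ^+ 2 - 4 * pos (v - 2^-1) ^+ 2 + 2 * pos (v - 1) ^+ 2.

Definition step_deriv v : R := 4 * (pos v - 2 * pos (v - 2^-1) + pos (v - 1)).

Lemma is_derive_step v : is_derive v 1 step (step_deriv v).
Proof.
have sh c : is_derive v 1 (fun t => pos (t - c) ^+ 2) (2 * pos (v - c)).
  rewrite -[X in is_derive _ _ _ X]mulr1.
  apply: (is_derive1_comp (f := fun t => pos t ^+ 2) (g := fun t => t - c)).
    exact: is_derive_sqr_pos.
  by have := is_deriveB (is_derive_id v 1) (is_derive_cst c v 1); rewrite subr0.
have d2 := is_deriveZ 2 (is_derive_sqr_pos v).
have d4 := is_deriveZ 4 (sh 2^-1).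
have d1 := is_deriveZ 2 (sh 1).
have -> : step_deriv v = 2 *: (2 * pos v) - 4 *: (2 * pos (v - 2^-1))
    + 2 *: (2 * pos (v - 1)) by rewrite /GRing.scale /= /step_deriv; ring.
exact: is_deriveD (is_deriveB d2 d4) d1.
Qed.

Lemma continuous_step_deriv : continuous step_deriv.
Proof.
move=> v.
have cp c : (fun t => pos (t - c)) @ v --> pos (v - c).
  apply: (@continuous_comp _ _ _ (fun t => t - c) pos v); last exact: continuous_pos.
  exact: (cvgB cvg_id (cvg_cst c)).
apply: cvgMl_tmp; apply: cvgD; last exact: cp.
by apply: cvgB; [exact: continuous_pos | apply: cvgMl_tmp; exact: cp].
Qed.

Lemma step_ge1 v : 1 <= v -> step v = 1 /\ step_deriv v = 0.
Proof.
move=> v1; rewrite /step /step_deriv !pos_ge; lra.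
Qed.

Lemma step_le0 v : v <= 0 -> step v = 0 /\ step_deriv v = 0.
Proof. by move=> v0; rewrite /step /step_deriv !pos_le; lra. Qed.

Lemma step_bounds v : 0 <= step v <= 1 /\ 0 <= step_deriv v <= 2.
Proof.
have [v0|v0] := leP v 0; first by have [-> ->] := step_le0 v0; split; lra.
have [v1|v1] := leP 1 v; first by have [-> ->] := step_ge1 v1; split; lra.
rewrite /step /step_deriv (pos_ge (ltW v0)) (@pos_le (v - 1)); last lra.
have [vh|vh] := leP v 2^-1.
  by rewrite (@pos_le (v - 2^-1)); last lra; split; apply/andP; split; nra.
by rewrite (@pos_ge (v - 2^-1)); last lra; split; apply/andP; split; nra.
Qed.

(** For [t >= 0] this is t^(1/2^m), written with square roots so as to be definable in every [D]. *)
Definition iter_sqrt (m : nat) t : R := iter m Num.sqrt t.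

Lemma iter_sqrt_gt0 m t : 0 < t -> 0 < iter_sqrt m t.
Proof. by move=> t0; elim: m => //= m IH; rewrite sqrtr_gt0. Qed.

Lemma iter_sqrt_homo m : {homo iter_sqrt m : s t / s <= t}.
Proof. by move=> s t st; elim: m => //= m IH; exact: ler_wsqrtr. Qed.

Lemma iter_sqrtK m t : 0 <= t -> iter_sqrt m (t ^+ (2 ^ m)) = t.
Proof.
move=> t0; elim: m => [|m IH]; first by rewrite expr1.
rewrite /iter_sqrt iterSr expnSr exprM sqrtr_sqr ger0_norm ?exprn_ge0 //.
Qed.

Lemma is_derive_iter_sqrt m t : 0 < t ->
  is_derive t 1 (iter_sqrt m) (iter_sqrt m t / (2 ^+ m * t)).
Proof.
move=> t0; elim: m => [|m IH].
  by rewrite /= expr0 mul1r divff ?gt_eqF //; exact: is_derive_id.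
have s0 := iter_sqrt_gt0 m t0.
have := is_derive1_comp (is_derive1_sqrt s0) IH.
rewrite (_ : (_ * _)%R = iter_sqrt m.+1 t / (2 ^+ m.+1 * t)) //=.
have r0 : 0 < Num.sqrt (iter_sqrt m t) by rewrite sqrtr_gt0.
have -> : iter_sqrt m t = Num.sqrt (iter_sqrt m t) ^+ 2.
  by rewrite sqr_sqrtr // ltW.
rewrite sqrtr_sqr ger0_norm ?ltW // (exprS 2 m).
have m0 : 0 < 2 ^+ m :> R by rewrite exprn_gt0.
move: r0 m0; move: (Num.sqrt _) (2 ^+ m) => r a r0 a0.
by field; rewrite !gt_eqF.
Qed.

Lemma flat_cutoff (D : forall k : nat, set (set 'rV[R]_k))
    (D_omin : ominimal_structure D) (kappa : R) : 0 < kappa ->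
  exists theta theta' : R -> R,
  [/\ forall X (cX : coordinates R X) (f : X -> R),
        definable_fun D f -> definable_fun D (fun x : X => theta (f x)),
      (forall t : R, is_derive t 1 theta (theta' t)) /\ continuous theta',
      (forall t, 0 <= theta t <= 1) /\ (forall t, `|t * theta' t| <= kappa),
      (exists2 delta, 0 < delta & forall t, t < delta -> theta t = 1) &
      forall t, 2^-1 <= t -> theta t = 0 /\ theta' t = 0].
Proof.
move=> k0.
have [m mk] : exists m, 4 / 2 ^+ m <= kappa.
  exists (Num.truncn (4 / kappa)).+1.
  rewrite ler_pdivrMr ?exprn_gt0 // mulrC -ler_pdivrMr //.
  apply: le_trans (ltW (truncnS_gt _)) _.
  rewrite -natrX ler_nat; exact/ltnW/ltn_expl.
set c := iter_sqrt m 2^-1.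
have c0 : 0 < c by apply: iter_sqrt_gt0; rewrite invr_gt0.
set w := fun t => 2 / c * iter_sqrt m t - 1.
exists (fun t => 1 - step (w t)).
exists (fun t => - (step_deriv (w t) * (2 / c * (iter_sqrt m t / (2 ^+ m * t))))).
set delta := (c / 2) ^+ (2 ^ m).
have delta0 : 0 < delta by rewrite exprn_gt0 // divr_gt0.
have c20 : 0 <= 2 / c by rewrite divr_ge0 // ltW.
have small t : t <= delta -> w t <= 0.
  move=> /(iter_sqrt_homo m); rewrite iter_sqrtK ?divr_ge0 ?(ltW c0) // => st.
  have := ler_wpM2l c20 st.
  have -> : 2 / c * (c / 2) = 1 by field; rewrite gt_eqF.
  by rewrite subr_le0.
have large t : 2^-1 <= t -> 1 <= w t.
  move=> /(iter_sqrt_homo m) st; have := ler_wpM2l c20 st.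
  have -> : 2 / c * iter_sqrt m 2^-1 = 2 by rewrite -/c; field; rewrite gt_eqF.
  by rewrite /w; lra.
have dw t : 0 < t -> is_derive t 1 w (2 / c * (iter_sqrt m t / (2 ^+ m * t))).
  move=> t0; have := is_deriveB (is_deriveZ (2 / c) (is_derive_iter_sqrt m t0))
                                (is_derive_cst (1 : R) t 1).
  by rewrite subr0.
split.
- move=> X cX f df.
  have dpos (g : X -> R) : definable_fun D g -> definable_fun D (fun x : X => pos (g x)).
    move=> dg; apply: (@definable_funE _ _ _ _ _ (fun x : X => if 0 <= g x then g x else 0)).
      by move=> x; case: (leP 0 (g x)) => g0; [rewrite pos_ge | rewrite pos_le // ltW].
    apply: definable_fun_if => //; last exact: definable_fun_cst.
    by apply: definable_le => //; exact: definable_fun_cst.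
  have dsq (a b : R) (g : X -> R) : definable_fun D g ->
      definable_fun D (fun x : X => a * pos (g x - b) ^+ 2).
    move=> dg; apply: definable_fun_mul => //; first exact: definable_fun_cst.
    have dpb : definable_fun D (fun x : X => pos (g x - b)).
      by apply: dpos; apply: definable_fun_sub => //; exact: definable_fun_cst.
    exact: definable_fun_mul.
  have dw' : definable_fun D (fun x : X => w (f x)).
    apply: definable_fun_sub => //; last exact: definable_fun_cst.
    apply: definable_fun_mul => //; first exact: definable_fun_cst.
    by rewrite /iter_sqrt; elim: (m) => [|k IH] //=; exact: definable_fun_sqrt.
  apply: definable_fun_sub => //; first exact: definable_fun_cst.
  apply: definable_fun_add => //; last exact: dsq.
  apply: definable_fun_sub => //; last exact: dsq.
  apply: (@definable_funE _ _ _ _ _ (fun x : X => 2 * pos (w (f x) - 0) ^+ 2)).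
    by move=> x; rewrite subr0.
  exact: dsq.
- have formula t : 0 < t -> is_derive t 1 (fun s => 1 - step (w s))
      (- (step_deriv (w t) * (2 / c * (iter_sqrt m t / (2 ^+ m * t))))).
    move=> t0; have := is_deriveB (is_derive_cst (1 : R) t 1)
      (is_derive1_comp (is_derive_step (w t)) (dw t t0)).
    by rewrite sub0r.
  split => t; have [t0|t0] := ltP 0 t.
  + exact: formula.
  + have td : t < delta by exact: le_lt_trans delta0.
    have [_ ->] := step_le0 (small t (ltW td)); rewrite mul0r oppr0.
    have e : \forall s \near t, 1 = 1 - step (w s).
      near=> s; have st : s <= delta by apply: ltW; near: s; exact: lt_nbhsl.
      by have [-> _] := step_le0 (small s st); rewrite subr0.
    exact: (near_eq_is_derive e (is_derive_cst (1 : R) t 1)).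
  + have cw : {for t, continuous w}.
      apply: differentiable_continuous; apply/derivable1_diffP.
      by have [] := dw t t0.
    have cs : {for t, continuous (iter_sqrt m)}.
      apply: differentiable_continuous; apply/derivable1_diffP.
      by have [] := is_derive_iter_sqrt m t0.
    apply: cvgN; apply: cvgM.
      exact: (continuous_comp cw (@continuous_step_deriv _)).
    apply: cvgMl_tmp; apply: cvgM; first exact: cs.
    apply: cvgV; first by rewrite mulf_neq0 ?gt_eqF ?exprn_gt0.
    exact: (cvgMl_tmp (cvg_id)).
  + have td : t < delta by exact: le_lt_trans delta0.
    have e : \forall s \near t,
        0 = - (step_deriv (w s) * (2 / c * (iter_sqrt m s / (2 ^+ m * s)))).
      near=> s; have st : s <= delta by apply: ltW; near: s; exact: lt_nbhsl.
      by have [_ ->] := step_le0 (small s st); rewrite mul0r oppr0.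
    rewrite /continuous_at -(nbhs_singleton e).
    exact: cvg_trans (near_eq_cvg e) (cvg_cst _).
- split => t; first by have [/andP[s0 s1] _] := step_bounds (w t); lra.
  have [t0|t0] := leP t 0.
    have [_ ->] := step_le0 (small t (le_trans t0 (ltW delta0))).
    by rewrite mul0r oppr0 mulr0 normr0 ltW.
  have [t1|t1] := leP 2^-1 t.
    by have [_ ->] := step_ge1 (large t t1); rewrite mul0r oppr0 mulr0 normr0 ltW.
  have st : iter_sqrt m t <= c by apply: iter_sqrt_homo; exact: ltW.
  have st0 := iter_sqrt_gt0 m t0.
  have m0 : 0 < 2 ^+ m :> R by rewrite exprn_gt0.
  have -> : t * - (step_deriv (w t) * (2 / c * (iter_sqrt m t / (2 ^+ m * t)))) =
      - (step_deriv (w t) * (2 / 2 ^+ m) * (iter_sqrt m t / c)).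
    by field; rewrite !gt_eqF.
  have [_ /andP[s0 s2]] := step_bounds (w t).
  have sc : 0 <= iter_sqrt m t / c <= 1.
    by rewrite divr_ge0 ?(ltW st0) ?(ltW c0) //= ler_pdivrMr // mul1r.
  have a0 : 0 <= 2 / 2 ^+ m :> R by rewrite divr_ge0 // ltW.
  rewrite normrN ger0_norm; last first.
    by case/andP: sc => sc0 _; apply: mulr_ge0 => //; exact: mulr_ge0.
  apply: le_trans mk; case/andP: sc => sc0 sc1.
  have -> : 4 / 2 ^+ m = 2 * (2 / 2 ^+ m) :> R by rewrite mulrA -natrM.
  apply: le_trans (ler_piMr (mulr_ge0 s0 a0) sc1) _.
  exact: ler_wpM2r.
- exists delta => // t td.
  by have [-> _] := step_le0 (small t (ltW td)); rewrite subr0.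
- move=> t t1; have [-> ->] := step_ge1 (large t t1).
  by rewrite subrr mul0r oppr0.
Unshelve. all: by end_near. Qed.

End FlatCutoff.

Section Cutoff.
Variables (R : realType) (D : forall n : nat, set (set 'rV[R]_n)).
Hypothesis D_omin : ominimal_structure D.

Lemma cutoff n (P F : set 'rV[R]_n) (kappa : R) : D P -> D F -> 0 < kappa ->
  exists chi : 'rV[R]_n -> R,
  [/\ definable_fun D chi /\ (forall x, 0 <= chi x <= 1),
      (forall x, ~ (closure P x /\ closure F x) -> C1_near x chi),
      (forall x, P x -> ~ closure F x -> \forall y \near x, chi y = 1),
      (forall x, closure F x -> ~ closure P x -> \forall y \near x, chi y = 0) &
      forall x, ~ (closure P x /\ closure F x) ->
        (chi x = 0 /\ gradient chi x = 0) \/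
        forall rho, 0 < rho -> sqdist_lower_bound P x rho ->
          sqnorm (gradient chi x) * rho <= kappa /\
          sqdist_lower_bound F x (rho / 2)].
Proof.
move=> dP dF kappa0; have [P0|P0] := eqVneq P set0.
  exists (fun=> 0); split.
  - by split => [|x]; [exact: definable_fun_cst | rewrite lexx ler01].
  - by move=> x _; exact: C1_near_cst.
  - by move=> x; rewrite P0.
  - by move=> x _ _; exact: near_all.
  - by move=> x _; left; rewrite gradient_cst.
have {}P0 : P !=set0 by apply/set0P.
have [p [Gp [[dp p0] [cp cGp] [Dp bp] pz [_ /(_ P0) plb]]]] := regularized_sqdist D_omin dP.
have [q [Gq [[dq q0] [cq cGq] [Dq bq] qz [qub _]]]] := regularized_sqdist D_omin dF.
have k'0 : 0 < Num.sqrt (kappa / 128) by rewrite sqrtr_gt0 divr_gt0.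
have [th [th' [dth [Dth cth'] [th01 thk] [delta delta0 th1] thz]]] :=
  flat_cutoff D_omin k'0.
have C1reg (h : 'rV[R]_n -> R) (G : 'rV[R]_n -> 'rV[R]_n) x : continuous h ->
    (forall i, continuous (fun x => G x 0 i)) ->
    (forall x i, is_derive x (delta_mx 0 i) h (G x 0 i)) -> C1_near x h.
  move=> ch cG Dh; apply: (@C1_nearP _ _ _ _ (fun i y => G y 0 i)).
  by apply: near_all => y; split; [exact: ch | move=> i; split; [exact: Dh | exact: cG]].
pose r x := p x * (p x + q x)^-1.
have pq0 x : ~ (closure P x /\ closure F x) -> 0 < p x + q x.
  move=> nPF; rewrite lt_def addr_ge0 // andbT; apply/eqP => /eqP.
  by rewrite paddr_eq0 // => /andP[/eqP/pz ? /eqP/qz ?]; apply: nPF.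
have C1r x : ~ (closure P x /\ closure F x) -> C1_near x r.
  move=> nPF; have Cp := C1reg p Gp x cp cGp Dp; have Cq := C1reg q Gq x cq cGq Dq.
  apply: (C1_near_mul Cp); apply: (C1_near_inv _ (C1_near_add Cp Cq)).
  by rewrite gt_eqF // pq0.
exists (fun x => th (r x)); split.
- split; last by move=> x; exact: th01.
  apply: (dth _ _ r); apply: definable_fun_mul => //.
  by apply: definable_fun_inv => //; exact: definable_fun_add.
- by move=> x nPF; exact: (C1_near_comp Dth cth' (C1r x nPF)).
- move=> x Px nF.
  have nPF : ~ (closure P x /\ closure F x) by case.
  have rx : r x < delta.
    by rewrite /r (pz x).2 ?mul0r //; exact: subset_closure.
  have near_r := cvgr_lt _ (C1_near_continuous (C1r x nPF)) _ rx.
  exact: (@filterS _ (nbhs x) (nbhs_filter x) _ _ (fun y => @th1 (r y))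
            (near_r (nbhs_filter x))).
- move=> x Fx nP.
  have nPF : ~ (closure P x /\ closure F x) by case.
  have rx : 2^-1 < r x.
    have := pq0 x nPF; rewrite /r (qz x).2 // addr0 => px.
    by rewrite divff ?gt_eqF // invf_lt1 // ltr1n.
  have near_r := cvgr_gt _ (C1_near_continuous (C1r x nPF)) _ rx.
  exact: (@filterS _ (nbhs x) (nbhs_filter x) _ _
            (fun y h => (thz (r y) (ltW h)).1) (near_r (nbhs_filter x))).
- move=> x nPF; have s0 := pq0 x nPF.
  have gradE : gradient (fun x => th (r x)) x =
      (th' (r x) / (p x + q x) ^+ 2) *: (q x *: Gp x - p x *: Gq x).
    apply/rowP => i; rewrite !mxE.
    have s0' : p x + q x != 0 by rewrite gt_eqF.
    have dpq := is_deriveD (Dp x i) (Dq x i).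
    have dinv : is_derive x (delta_mx 0 i) (fun y => (p y + q y)^-1)
        (- (p x + q x) ^- 2 *: (Gp x 0 i + Gq x 0 i)).
      apply: DeriveDef; first by apply: derivableV => //; exact: ex_derive.
      by rewrite deriveV // derive_val.
    have := is_derive_chain (Dth (r x)) (is_deriveM (Dp x i) dinv).
    move=> dchi; rewrite (derive_val (is_derive := dchi)) /GRing.scale /=.
    by field.
  have [rx|rx] := leP 2^-1 (r x).
    by left; have [-> th'0] := thz _ rx; rewrite gradE th'0 mul0r scale0r.
  right => rho rho0 /plb rhop.
  have pltq : p x < q x by move: rx; rewrite /r ltr_pdivrMr //; lra.
  have px0 : 0 < p x by exact: lt_le_trans rhop.
  split; last first.
    by move=> y Fy; have := qub x y Fy; lra.
  rewrite gradE sqnormZ.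
  have A1 : sqnorm (q x *: Gp x - p x *: Gq x) <= 128 * (p x * q x * (p x + q x)).
    apply: le_trans (sqnormD_le2 _ _) _; rewrite sqnormN !sqnormZ.
    have := ler_wpM2l (sqr_ge0 (q x)) (bp x); have := ler_wpM2l (sqr_ge0 (p x)) (bq x).
    by move=> H1 H2; nra.
  have A2 : (r x * th' (r x)) ^+ 2 <= kappa / 128.
    rewrite -[leRHS]sqr_sqrtr ?divr_ge0 ?(ltW kappa0) //.
    by rewrite -real_normK ?num_real // ler_sqr ?nnegrE ?sqrtr_ge0 ?thk.
  move: A1 A2; rewrite {1}/r; move: (th' (r x)) => t.
  have := sqnorm_ge0 (q x *: Gp x - p x *: Gq x).
  move: (sqnorm _) => A A0 A1 A2.
  have u2 := sqr_ge0 (t / (p x + q x) ^+ 2).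
  apply: le_trans (ler_wpM2r (ltW rho0) (ler_wpM2l u2 A1)) _.
  have B0 : 0 <= (t / (p x + q x) ^+ 2) ^+ 2 * (128 * (p x * q x * (p x + q x))).
    do 2!apply: mulr_ge0 => //; apply: mulr_ge0; last exact: ltW.
    exact: mulr_ge0.
  apply: le_trans (ler_wpM2l B0 rhop) _.
  have -> : (t / (p x + q x) ^+ 2) ^+ 2 * (128 * (p x * q x * (p x + q x))) * p x =
      128 * (p x / (p x + q x) * t) ^+ 2 * (q x / (p x + q x)).
    by field; rewrite gt_eqF.
  have qs : q x / (p x + q x) <= 1 by rewrite ler_pdivrMr // mul1r lerDr.
  have C0 : 0 <= 128 * (p x / (p x + q x) * t) ^+ 2 by rewrite mulr_ge0 ?sqr_ge0.
  by apply: le_trans (ler_piMr C0 qs) _; lra.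
Qed.

End Cutoff.

(** * Partition of unity *)

Section PartitionOfUnity.
Variables (R : realType) (D : forall n : nat, set (set 'rV[R]_n)).
Hypothesis D_omin : ominimal_structure D.

Definition initial_union n (P : nat -> set 'rV[R]_n) (k : nat) : set 'rV[R]_n :=
  [set x | exists2 j, (j < k)%N & P j x].

Lemma definable_initial_union n (P : nat -> set 'rV[R]_n) k :
  (forall j, D (P j)) -> D (initial_union P k).
Proof.
move=> dP; apply: (@definable_setE _ D _ (coordinates_rV R n) (initial_union P k)
    (fun x => exists j : 'I_k, P j x)); last first.
  by apply: definable_exists_fin => // j; exact: dP.
by move=> x; split => [[j jk Pj]|[j Pj]]; [exists (Ordinal jk) | exists j].
Qed.

Lemma gradient_1B n (f : 'rV[R]_n -> R) x : C1_near x f ->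
  gradient (fun y => 1 - f y) x = - gradient f x.
Proof.
move=> Cf; rewrite gradient_add; [|exact: C1_near_cst|exact: C1_near_opp].
by rewrite gradient_cst add0r gradient_opp.
Qed.

Lemma partition_of_unity n (N : nat) (P U : nat -> set 'rV[R]_n)
    (A : set 'rV[R]_n) (kappa : R) :
  (forall k, D (P k)) -> (forall k, D (U k)) ->
  (forall k, P k `<=` interior (U k)) ->
  (forall x, A x -> initial_union P N x) ->
  (forall j k x, P j x -> P k x -> j = k) ->
  (forall k x, (k <= N)%N -> A x -> closure (initial_union P k) x ->
     initial_union P k x) ->
  0 < kappa ->
  exists phi : nat -> 'rV[R]_n -> R,
  [/\ (forall k, definable_fun D (phi k)) /\ (forall k x, 0 <= phi k x <= 1),
      forall x, A x -> \sum_(k < N) phi k x = 1,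
      forall k x, (k < N)%N -> A x -> C1_near x (phi k),
      forall k x, (k < N)%N -> A x -> ~ U k x -> \forall y \near x, phi k y = 0 &
      forall k x, (k < N)%N -> A x -> forall rho, 0 < rho ->
        sqdist_lower_bound (P k) x rho ->
        sqnorm (gradient (phi k) x) * rho <= kappa].
Proof.
move=> dP dU PU AP Pdisj Pclosed kappa0.
pose F k := initial_union P k `|` ~` U k.
have dF k : D (F k).
  apply: (omin_setU D_omin); first exact: definable_initial_union.
  exact: (omin_setC D_omin).
set kappa' := kappa / (2 * 4 ^+ N).
have fourN : 0 < 2 * 4 ^+ N :> R by rewrite mulr_gt0 ?exprn_gt0.
have kappa'0 : 0 < kappa' by rewrite divr_gt0.
have /choice[chi Hchi] := fun k => cutoff D_omin (dP k) (dF k) kappa'0.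
have closureF k x : closure (F k) x ->
    closure (initial_union P k) x \/ ~ interior (U k) x.
  rewrite closureU => -[|]; first by left.
  by rewrite closure_setC; right.
have chi01 k x : 0 <= chi k x <= 1 by have [[_ H] _ _ _ _] := Hchi k.
have good j k x : (j < N)%N -> A x -> P j x -> (k <= j)%N ->
    ~ (closure (P k) x /\ closure (F k) x).
  move=> jN Ax Pj kj [clP /closureF[clZ|nU]].
    have [i ik Pi] := Pclosed k x (leq_trans kj (ltnW jN)) Ax clZ.
    by move: ik; rewrite (Pdisj _ _ _ Pi Pj) ltnNge kj.
  have [i ik Pi] : initial_union P k.+1 x.
    apply: Pclosed => //; first exact: leq_ltn_trans kj jN.
    by apply: closure_subset clP => y Py; exists k.
  have ij := Pdisj _ _ _ Pi Pj; rewrite ij ltnS in ik.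
  have ejk : j = k by apply/eqP; rewrite eqn_leq ik kj.
  by apply: nU; apply: PU; rewrite -ejk.
have chi1 j x : (j < N)%N -> A x -> P j x -> \forall y \near x, chi j y = 1.
  move=> jN Ax Pj; have [_ _ one _ _] := Hchi j; apply: one => // clF.
  by apply: (good j j x jN Ax Pj (leqnn j)); split => //; exact: subset_closure.
have C1chi j k x : (j < N)%N -> A x -> P j x -> (k <= j)%N -> C1_near x (chi k).
  by move=> jN Ax Pj kj; have [_ C1 _ _ _] := Hchi k; apply: C1; exact: good jN Ax Pj kj.
pose omega k x := \prod_(i < k) (1 - chi i x).
pose phi k x := chi k x * omega k x.
have omegaS k x : omega k.+1 x = omega k x * (1 - chi k x) by rewrite /omega big_ord_recr.
have omega01 k x : 0 <= omega k x <= 1.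
  elim: k => [|k IH]; first by rewrite /omega big_ord0 lexx ler01.
  rewrite omegaS; have /andP[c0 c1] := chi01 k x; have /andP[w0 w1] := IH.
  by rewrite mulr_ge0 ?subr_ge0 //= mulr_ile1 ?subr_ge0 // lerBlDr lerDl.
have omega0 j k x : (j < N)%N -> A x -> P j x -> (j < k)%N ->
    \forall y \near x, omega k y = 0.
  move=> jN Ax Pj jk; apply: filterS (chi1 j x jN Ax Pj) => y chiy.
  by rewrite /omega (bigD1 (Ordinal jk)) //= chiy subrr mul0r.
have C1omega j k x : (j < N)%N -> A x -> P j x -> (k <= j.+1)%N -> C1_near x (omega k).
  move=> jN Ax Pj; elim: k => [_|k IH kj].
    by apply: C1_near_eq (C1_near_cst x 1); apply: near_all => y; rewrite /omega big_ord0.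
  apply: (@C1_near_eq _ _ _ (fun y => omega k y * (1 - chi k y))).
    by apply: near_all => y; rewrite omegaS.
  apply: C1_near_mul; first by apply: IH; exact: ltnW.
  apply: C1_near_sub; first exact: C1_near_cst.
  exact: C1chi jN Ax Pj _.
have phi0 j k x : (j < N)%N -> A x -> P j x -> (j < k)%N ->
    \forall y \near x, phi k y = 0.
  move=> jN Ax Pj jk; apply: filterS (omega0 j k x jN Ax Pj jk) => y oy.
  by rewrite /phi oy mulr0.
exists phi; split.
- split => [k|k x].
    apply: definable_fun_mul => //; first by have [[d _] _ _ _ _] := Hchi k.
    elim: k => [|k IH].
      apply: (@definable_funE _ _ _ _ _ (fun=> 1)); last exact: definable_fun_cst.
      by move=> x; rewrite /omega big_ord0.
    apply: (@definable_funE _ _ _ _ _ (fun x => omega k x * (1 - chi k x))) => //.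
    apply: definable_fun_mul => //; apply: definable_fun_sub => //.
      exact: definable_fun_cst.
    by have [[d _] _ _ _ _] := Hchi k.
  have /andP[c0 c1] := chi01 k x; have /andP[w0 w1] := omega01 k x.
  by rewrite mulr_ge0 //= mulr_ile1.
- move=> x Ax; have [j jN Pj] := AP x Ax.
  have tele m : \sum_(k < m) phi k x = 1 - omega m x.
    elim: m => [|m IH]; first by rewrite /omega !big_ord0 subrr.
    by rewrite big_ord_recr /= IH omegaS /phi; ring.
  by rewrite tele (nbhs_singleton (omega0 j N x jN Ax Pj jN)) subr0.
- move=> k x kN Ax; have [j jN Pj] := AP x Ax.
  have [jk|kj] := ltnP j k.
    apply: C1_near_eq (C1_near_cst x 0).
    by apply: filterS (phi0 j k x jN Ax Pj jk) => y ->.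
  apply: C1_near_mul; first exact: C1chi jN Ax Pj kj.
  by apply: C1omega jN Ax Pj _; exact: leqW.
- move=> k x kN Ax nU; have [j jN Pj] := AP x Ax.
  have [jk|kj] := ltnP j k; first exact: phi0 jN Ax Pj jk.
  have clF : closure (F k) x by apply: subset_closure; right.
  have [_ _ _ zero _] := Hchi k.
  have nP : ~ closure (P k) x by move=> clP; exact: (good j k x jN Ax Pj kj).
  by apply: filterS (zero x clF nP) => y cy; rewrite /phi cy mul0r.
- move=> k x kN Ax rho rho0 rhoP; have [j jN Pj] := AP x Ax.
  have [jk|kj] := ltnP j k.
    rewrite (@gradient_near_eq _ _ _ _ (fun=> 0)); last exact: phi0 jN Ax Pj jk.
    by rewrite gradient_cst sqnorm0 mul0r ltW.
  have Ck := C1chi j k x jN Ax Pj kj.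
  have Co i : (i <= k)%N -> C1_near x (omega i).
    by move=> ik; apply: C1omega jN Ax Pj _; exact: leqW (leq_trans ik kj).
  have [_ _ _ _ /(_ x (good j k x jN Ax Pj kj)) [[chi0 grad0]|H]] := Hchi k.
    rewrite (gradient_mul Ck (Co k (leqnn k))).
    by rewrite chi0 grad0 scaler0 scale0r addr0 sqnorm0 mul0r ltW.
  have [bk lbF] := H rho rho0 rhoP.
  set B := 2 * kappa' / rho.
  have B0 : 0 <= B by rewrite divr_ge0 ?mulr_ge0 // ltW.
  have Bk : sqnorm (gradient (chi k) x) <= B.
    rewrite ler_pdivlMr //; lra.
  have Bi i : (i < k)%N -> sqnorm (gradient (chi i) x) <= B.
    move=> ik; have ij := leq_trans (ltnW ik) kj.
    have [_ _ _ _ /(_ x (good j i x jN Ax Pj ij)) [[_ ->]|Hi]] := Hchi i.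
      by rewrite sqnorm0.
    have lbi : sqdist_lower_bound (P i) x (rho / 2).
      by move=> y Py; apply: lbF; left; exists i.
    have [bi _] := Hi (rho / 2) (divr_gt0 rho0 (ltr0Sn _ 1)) lbi.
    rewrite ler_pdivlMr //; lra.
  have Bomega i : (i <= k)%N -> sqnorm (gradient (omega i) x) <= 4 ^+ i * B.
    elim: i => [_|i IH ik].
      rewrite (@gradient_near_eq _ _ _ _ (fun=> 1)); last first.
        by apply: near_all => y; rewrite /omega big_ord0.
      by rewrite gradient_cst sqnorm0 expr0 mul1r.
    rewrite (@gradient_near_eq _ _ _ _ (fun y => omega i y * (1 - chi i y))); last first.
      by apply: near_all => y; rewrite omegaS.
    have Ci := C1chi j i x jN Ax Pj (leq_trans (ltnW ik) kj).
    rewrite exprS -mulrA; apply: sqnorm_gradient_mul.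
    - exact: Co (ltnW ik).
    - exact: (C1_near_sub (C1_near_cst x 1) Ci).
    - exact: omega01.
    - by have /andP[c0 c1] := chi01 i x; rewrite subr_ge0 c1 lerBlDr lerDl.
    - exact: IH (ltnW ik).
    rewrite gradient_1B // sqnormN; apply: le_trans (Bi i ik) _.
    by rewrite ler_peMl // exprn_ege1 // ler1n.
  have : sqnorm (gradient (phi k) x) <= 4 * (4 ^+ k * B).
    apply: (sqnorm_gradient_mul Ck (Co k (leqnn k)) (chi01 k x) (omega01 k x) _
              (Bomega k (leqnn k))).
    by apply: le_trans Bk _; rewrite ler_peMl // exprn_ege1 // ler1n.
  move=> /(ler_wpM2r (ltW rho0)) /le_trans; apply.
  rewrite mulrA -exprS -mulrA divfK ?gt_eqF //.
  have -> : kappa = 4 ^+ N * (2 * kappa').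
    by rewrite /kappa'; field; rewrite gt_eqF // exprn_gt0.
  apply: ler_wpM2r; first by rewrite mulr_ge0 // ltW.
  by apply: ler_weXn2l => //; rewrite ler1n.
Qed.

End PartitionOfUnity.

Lemma closed_frontier (R : realType) (n : nat) (S : set 'rV[R]_n) (k : nat) :
  Ck_submanifold k S -> closed (closure S `\` S).
Proof.
move=> Sk x clx; have clSx : closure S x.
  by apply: closed_closure; apply: closure_subset clx => y [].
split => // Sx.
have [d [V [W [h [_ [Vo Vx] _ [g [Ckh _ _ _]] SV]]]]] := Sk x Sx.
have hc y : V y -> {for y, continuous h} by case: k Sk Ckh => [|k] _ [H _]; exact: H.
have [y [[clSy nSy] Vy]] := clx V (open_nbhs_nbhs (conj Vo Vx)).
apply: nSy; apply/(SV y Vy) => i di; apply: contrapT => hy0.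
have hyi : {for y, continuous (fun z => h z 0 i)}.
  exact: (continuous_comp (hc y Vy) (@coord_continuous _ _ _ 0 i _)).
have near_h : \forall z \near y, h z 0 i != 0.
  by apply: (cvgr_neq0 _ hyi); apply/eqP.
have near_V : \forall z \near y, V z by exact: open_nbhs_nbhs.
have [z [Sz [hz Vz]]] := clSy _ (filterI near_h near_V).
by move/eqP: hz; apply; exact: (SV z Vz).1.
Qed.

(* Let [J x] be the set of those closed sets, among the closures and frontiers of
   the [S s], that contain [x].  Near [x] one has [J y \subset J x], so ordering the
   pieces [{x in S s | J x = K}] by decreasing [#|K|] makes their initial unions
   relatively closed. *)
Lemma refinement (R : realType) (D : forall n : nat, set (set 'rV[R]_n))
    (D_omin : ominimal_structure D) (n : nat) (I : finType) (i0 : I)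
    (S : I -> set 'rV[R]_n) :
  (forall s, D n (S s)) -> (forall s, closed (closure (S s) `\` S s)) ->
  (forall s t x, S s x -> S t x -> s = t) ->
  exists (N : nat) (label : nat -> I) (P : nat -> set 'rV[R]_n),
  [/\ forall k, D n (P k), forall k, P k `<=` S (label k),
      forall s x, S s x -> initial_union P N x,
      forall j k x, P j x -> P k x -> j = k &
      forall k s x, (k <= N)%N -> S s x -> closure (initial_union P k) x ->
        initial_union P k x].
Proof.
move=> dS cS disjS.
pose T : finType := (I * bool)%type.
pose C (t : T) := if t.2 then closure (S t.1) else closure (S t.1) `\` S t.1.
have dC t : D n (C t).
  rewrite /C; have dcl := definable_closure D_omin (dS t.1).
  case: t.2 => //.
  exact: (@definable_and _ _ D_omin _ (coordinates_rV R n) (closure (S t.1))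
            (~` S t.1) dcl (omin_setC D_omin (dS t.1))).
have cC t : closed (C t) by rewrite /C; case: t.2 => //; exact: closed_closure.
have SC s x : S s x <-> C (s, true) x /\ ~ C (s, false) x.
  rewrite /C /=; split => [Sx|[clx nx]]; last by apply: contrapT => nSx; apply: nx.
  by split => [|[]]//; exact: subset_closure.
pose J (x : 'rV[R]_n) : {set T} := [set t | `[< C t x >]]%SET.
have JC t x : t \in J x <-> C t x by rewrite inE; split => /asboolP.
have Jusc x : \forall y \near x, J y \subset J x.
  have near_C t : \forall y \near x, C t y -> C t x.
    have [Ctx|nCtx] := pselect (C t x); first exact: near_all.
    have : nbhs x (~` C t) by apply: open_nbhs_nbhs; split => //; exact: closed_openC.
    by apply: filterS => y nCy /nCy.
  have := @filter_forall _ T (fun t y => C t y -> C t x) (nbhs x) (nbhs_filter x) near_C.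
  apply: filterS => y Cyx; apply/fintype.subsetP => t /JC Cty; apply/JC; exact: Cyx.
have S_J s x y : S s x -> J y = J x -> S s y.
  move=> /SC[Ct /JC nCf] Jyx; apply/SC; split; first by apply/JC; rewrite Jyx; apply/JC.
  by move=> /JC; rewrite Jyx.
pose X : finType := (I * {set T})%type.
pose larger (z w : X) := (#|w.2| <= #|z.2|)%N.
pose l := sort larger (enum X).
pose z0 : X := (i0, J 0).
pose Q (z : X) (x : 'rV[R]_n) := S z.1 x /\ J x = z.2.
have lQ s x : S s x -> (s, J x) \in l by rewrite mem_sort mem_enum.
have l_uniq : uniq l by rewrite sort_uniq enum_uniq.
exists (size l), (fun k => (nth z0 l k).1).
exists (fun k => [set x | (k < size l)%N /\ Q (nth z0 l k) x]).
set P := fun k => _; split.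
- move=> k.
  change (@definable_set R D _ (coordinates_rV R n) (fun x =>
    (k < size l)%N /\ S (nth z0 l k).1 x /\ J x = (nth z0 l k).2)).
  apply: definable_and => //; first exact: definable_const.
  apply: definable_and => //; first exact: dS.
  apply: (@definable_setE _ D _ (coordinates_rV R n) _
    (fun x => forall t, (C t x -> t \in (nth z0 l k).2) /\
                        (t \in (nth z0 l k).2 -> C t x))).
    move=> x; split => [<- t|H]; first by split => /JC.
    by apply/setP => t; apply/idP/idP => [/JC/H|/H/JC].
  apply: definable_forall_fin => // t.
  by apply: definable_and => //; apply: definable_imp => //;
    first [exact: dC | exact: definable_const].
- by move=> k x [_ []].
- move=> s x Sx; exists (index (s, J x) l); first by rewrite index_mem lQ.
  by split; rewrite ?index_mem ?nth_index ?lQ.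
- move=> j k x [jl [Sj Jj]] [kl [Sk Jk]].
  apply/eqP; rewrite -(nth_uniq z0 jl kl l_uniq); apply/eqP.
  move: (nth z0 l j) (nth z0 l k) Sj Jj Sk Jk => [a A] [b B] /= Sa <- Sb <-.
  by rewrite (disjS _ _ _ Sa Sb).
- move=> k s x kl Sx clP.
  have [y [[j jk [jl [Sj Jj]]] Jyx]] := clP _ (Jusc x).
  set i := index (s, J x) l.
  have il : (i < size l)%N by rewrite index_mem lQ.
  have ei : nth z0 l i = (s, J x) by rewrite nth_index ?lQ.
  exists i; last by split => //; rewrite ei.
  rewrite ltnNge; apply/negP => ki; have ji := leq_trans jk ki.
  have larger_sorted : sorted larger l.
    by apply: sort_sorted => a b; exact: leq_total.
  have larger_trans : transitive larger by move=> a b c ab bc; exact: leq_trans bc ab.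
  have := sorted_ltn_nth larger_trans z0 larger_sorted j i jl il ji.
  rewrite ei /larger /= -Jj => card_le.
  have Jxy : J x = J y by apply/esym/eqP; rewrite eqEcard Jyx.
  have e1 : (nth z0 l j).1 = s by apply: disjS Sj (S_J _ _ _ Sx (esym Jxy)).
  have : nth z0 l j = nth z0 l i.
    by rewrite ei Jxy Jj -e1; case: (nth z0 l j).
  by move/eqP; rewrite nth_uniq // => /eqP e; rewrite e ltnn in ji.
Qed.

Lemma sqnorm_gradient_sum (R : realType) (n : nat) (x : 'rV[R]_n) (T : Type)
    (r : seq T) (P : pred T) (f : T -> 'rV[R]_n -> R) (B : R) :
  (forall t, P t -> C1_near x (f t)) ->
  (forall t, P t -> sqnorm (gradient (f t) x) <= B) -> 0 <= B ->
  sqnorm (gradient (fun y => \sum_(t <- r | P t) f t y) x) <= 4 ^+ size r * B.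
Proof.
move=> Cf fB B0; elim: r => [|t r IH].
  rewrite (@gradient_near_eq _ _ _ _ (fun=> 0)); last first.
    by apply: near_all => y; rewrite big_nil.
  by rewrite gradient_cst sqnorm0 mulr_ge0.
have BB : B <= 4 ^+ size r * B by rewrite ler_peMl // exprn_ege1 // ler1n.
case Pt: (P t); last first.
  rewrite (@gradient_near_eq _ _ _ _ (fun y => \sum_(t <- r | P t) f t y)); last first.
    by apply: near_all => y; rewrite big_cons Pt.
  by apply: le_trans IH _; rewrite /= exprS -mulrA; lra.
rewrite (@gradient_near_eq _ _ _ _
  (fun y => f t y + \sum_(t <- r | P t) f t y)); last first.
  by apply: near_all => y; rewrite big_cons Pt.
rewrite (gradient_add (Cf t Pt) (C1_near_sum r Cf)).
apply: le_trans (sqnormD_le2 _ _) _; rewrite /= exprS -mulrA.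
have := fB t Pt; lra.
Qed.

Lemma euclidean_normE (R : realType) (n : nat) (x : 'rV[R]_n) :
  euclidean_norm x = Num.sqrt (sqnorm x).
Proof. by congr Num.sqrt; apply: eq_bigr => i _; rewrite expr2. Qed.

Lemma sqdist_lower_bound_euclidean (R : realType) (n : nat) (S : set 'rV[R]_n)
    (x : 'rV[R]_n) : 0 <= euclidean_dist x S ->
  sqdist_lower_bound S x (euclidean_dist x S ^+ 2).
Proof.
move=> d0 y Sy.
have : euclidean_dist x S <= euclidean_norm (x - y).
  apply: ge_inf; last by exists y.
  by exists 0 => _ [z _ <-]; exact: sqrtr_ge0.
rewrite euclidean_normE => dxy; rewrite -(sqr_sqrtr (sqnorm_ge0 (x - y))).
by rewrite ler_sqr ?nnegrE ?sqrtr_ge0.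
Qed.

Theorem theorem4p2 (R : realType) (D : forall n : nat, set (set 'rV[R]_n))
    (D_omin : ominimal_structure D) (D_poly : polynomially_bounded D)
    (n : nat) (A : set 'rV[R]_n)
    (A_lc : locally_closed A) (A_def : D n A)
    (I : finType) (S : I -> set 'rV[R]_n)
    (S_strat : Ck_stratification D 2 A S)
    (mu : R) (mu_gt0 : 0 < mu)
    (U : I -> set 'rV[R]_n)
    (U_nbhd : forall s : I, S s `<=` interior (U s))
    (U_def : forall s : I, D n (U s)) :
  (* phi s is the function on A, psi s its chosen C^1 extension *)
  exists phi psi : I -> 'rV[R]_n -> R,
    [/\ (forall s : I,
           definable_fun_on D A (phi s) /\ Ck_extension 1 A (phi s) (psi s)),
        (forall (s : I) x, A x -> 0 <= phi s x <= 1),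
        (forall x, A x -> \sum_(s : I) phi s x = 1),
        (forall s : I, support_in A (phi s) `<=` U s) &
        (* no constraint where the distance is 0: mu / 0 is read as +oo *)
        (forall (s : I) x, U s x -> A x -> ~ S s x ->
           0 < euclidean_dist x (S s) ->
           euclidean_norm (gradient (psi s) x)
             <= mu / euclidean_dist x (S s))].
Proof.
have [[coverS trivS _] stratS] := S_strat.
have AS x : A x -> exists s, S s x by rewrite -coverS => -[s _ Sx]; exists s.
have [i0 _|noI] := pickP (fun _ : I => true); last first.
  have A0 x : ~ A x by move=> /AS[s]; have := noI s.
  exists (fun _ _ => 0), (fun _ _ => 0).
  split=> [s|s x /A0//|x /A0//|s x [/A0//]|s x _ /A0//].
  split; last by apply: C1_near_Ck_extension => x /A0.
  by apply: definable_fun_on_definable_fun => //; exact: definable_fun_cst.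
have [N [label [P [dP PS SP Pdisj Pclosed]]]] : exists (N : nat) (label : nat -> I)
    (P : nat -> set 'rV[R]_n),
  [/\ forall k, D n (P k), forall k, P k `<=` S (label k),
      forall s x, S s x -> initial_union P N x,
      forall j k x, P j x -> P k x -> j = k &
      forall k s x, (k <= N)%N -> S s x -> closure (initial_union P k) x ->
        initial_union P k x].
  apply: (refinement D_omin i0) => [s|s|s t x Ss St]; first exact: (stratS s).1.
    exact: closed_frontier (stratS s).2.
  by apply: (trivS s t) => //; exists x.
set r := index_enum 'I_N.
have r0 : 0 < 4 ^+ size r :> R by rewrite exprn_gt0.
have kappa0 : 0 < mu ^+ 2 / 4 ^+ size r by rewrite divr_gt0 // exprn_gt0.
have [|||k x kN /AS[s Ss]|phi [[dphi phi01] phi_sum phiC1 phi_supp phi_grad]] :=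
  @partition_of_unity R D D_omin n N P (fun k => U (label k)) A _ dP _ _ _ Pdisj _ kappa0.
- by move=> k; exact: U_def.
- by move=> k x /PS; exact: U_nbhd.
- by move=> x /AS[s]; exact: SP.
- exact: Pclosed kN Ss.
pose Phi s y := \sum_(k < N | label k == s) phi k y.
have PhiC1 s x : A x -> C1_near x (Phi s).
  by move=> Ax; apply: C1_near_sum => k _; exact: phiC1.
have Phi_ge0 s x : 0 <= Phi s x.
  by apply: sumr_ge0 => k _; have /andP[] := phi01 k x.
have Phi_sum x : A x -> \sum_s Phi s x = 1.
  move=> Ax; rewrite -(phi_sum x Ax).
  by rewrite (partition_big (fun k : 'I_N => label k) xpredT).
exists Phi, Phi; split.
- move=> s; split; last exact: C1_near_Ck_extension (PhiC1 s).
  apply: definable_fun_on_definable_fun => //.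
  by apply: definable_fun_sum => // k; exact: dphi.
- move=> s x Ax; rewrite Phi_ge0 /= -(Phi_sum x Ax) (bigD1 s) //= lerDl.
  by apply: sumr_ge0.
- exact: Phi_sum.
- move=> s x [Ax clx]; apply: contrapT => nU.
  have near0 (k : 'I_N) : \forall y \near x, label k == s -> phi k y = 0.
    have [ks|ks] := eqVneq (label k) s; last exact: near_all.
    have := phi_supp k x (ltn_ord k) Ax; rewrite ks => /(_ nU).
    by apply: filterS => y ->.
  have [y [[_ /= /eqP Py] phi0]] :=
    clx _ (@filter_forall _ _ _ (nbhs x) (nbhs_filter x) near0).
  by apply: Py; apply: big1 => k; exact: phi0.
- move=> s x _ Ax _ d0; set d := euclidean_dist x (S s) in d0 *.
  have d20 : 0 < d ^+ 2 by rewrite exprn_gt0.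
  have lbS := sqdist_lower_bound_euclidean (ltW d0).
  set B := mu ^+ 2 / 4 ^+ size r / d ^+ 2.
  have B0 : 0 <= B by rewrite divr_ge0 // ltW.
  have : sqnorm (gradient (Phi s) x) <= 4 ^+ size r * B.
    apply: sqnorm_gradient_sum => // k /eqP ks; first exact: phiC1.
    rewrite ler_pdivlMr //; apply: phi_grad => // y /PS; rewrite ks; exact: lbS.
  have -> : 4 ^+ size r * B = (mu / d) ^+ 2 by rewrite /B; field; rewrite !gt_eqF.
  rewrite euclidean_normE => H.
  rewrite -[leRHS]ger0_norm ?divr_ge0 ?(ltW d0) ?(ltW mu_gt0) // -sqrtr_sqr.
  exact: ler_wsqrtr.
Qed.
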